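(* Let $n\ge 1$, let $X_1,\dots,X_n$ be independent, square integrable random variables with values in the lattice $\mathcal L(v_0,D)$, with $\vartheta_{X_j}>0$ for $j=1,\dots,n$, let $S_n=X_1+\dots+X_n$, and let $0<\vartheta_j\le\vartheta_{X_j}$ ($j=1,\dots,n$). Assume that $\Theta_n>1$ and $\frac{\log\Theta_n}{\Theta_n}\le\frac1{14}$. Then, for all $\kappa\in\mathcal L(v_0n,D)$ such that $$\frac{(\kappa-\mathbb E S_n)^2}{\mathrm{Var}(S_n)}\le\Big(\frac{\Theta_n}{14\log\Theta_n}\Big)^{1/2},$$ we have $$\Big|\mathbb P\{S_n=\kappa\}-\frac{D\,e^{-\frac{(\kappa-\mathbb E S_n)^2}{2\mathrm{Var}(S_n)}}}{\sqrt{2\pi\,\mathrm{Var}(S_n)}}\Big|\le C_2\Big\{D\Big(\frac{\log\Theta_n}{\mathrm{Var}(S_n)\,\Theta_n}\Big)^{1/2}+\frac{H_n+\Theta_n^{-1}}{\sqrt{\Theta_n}}\Big\},$$ with $C_2=12(C_1+1)$.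
   Context: Lattice: $v_0\in\mathbb R$ and $D>0$ are fixed, $v_k=v_0+Dk$ for $k\in\mathbb Z$, and $\mathcal L(v_0,D)=\{v_k:k\in\mathbb Z\}$; likewise $\mathcal L(v_0n,D)=\{v_0n+Dk:k\in\mathbb Z\}$. For a random variable $X$ with $\mathbb P\{X\in\mathcal L(v_0,D)\}=1$, put $\vartheta_X=\sum_{k\in\mathbb Z}\min(\mathbb P\{X=v_k\},\mathbb P\{X=v_{k+1}\})$. Bernoulli part: for each $j$, put $f_j(k)=\mathbb P\{X_j=v_k\}$ and $\tau_k^{(j)}=\frac{\vartheta_j}{\vartheta_{X_j}}\min(f_j(k),f_j(k+1))$ for $k\in\mathbb Z$. Let $(V_1,\varepsilon_1),\dots,(V_n,\varepsilon_n)$ be mutually independent pairs with laws $\mathbb P\{(V_j,\varepsilon_j)=(v_k,1)\}=\tau_k^{(j)}$ and $\mathbb P\{(V_j,\varepsilon_j)=(v_k,0)\}=f_j(k)-\frac{\tau_{k-1}^{(j)}+\tau_k^{(j)}}{2}$, $k\in\mathbb Z$. In particular $\mathbb P\{\varepsilon_j=1\}=1-\mathbb P\{\varepsilon_j=0\}=\vartheta_j$. Put $W_n=\sum_{j=1}^nV_j$, $B_n=\sum_{j=1}^n\varepsilon_j$, $S_n'=W_n+\frac D2B_n$, $\Theta_n=\sum_{j=1}^n\vartheta_j$, and $$H_n=\sup_{x\in\mathbb R}\Big|\mathbb P\Big\{\frac{S_n'-\mathbb E S_n'}{\sqrt{\mathrm{Var}(S_n')}}<x\Big\}-\mathbb P\{g<x\}\Big|,$$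 where $g$ is a standard normal random variable. Constants: $C_0$ is an absolute constant such that for all integers $N\ge1$, $\sup_{z\in\mathbb Z}\big|\mathbb P\{\mathcal B_N=z\}-\sqrt{\tfrac{2}{\pi N}}\,e^{-(2z-N)^2/(2N)}\big|\le C_0N^{-3/2}$, where $\mathcal B_N$ is a sum of $N$ i.i.d. variables taking the values $0$ and $1$ with probability $1/2$ each (such a constant exists). $C_1=\max(4,C_0)$. *)

(* Defs.v *)
From HB Require Import structures.
From mathcomp Require Import all_boot all_order all_algebra.
From mathcomp Require Import all_classical all_reals all_analysis.

Set Implicit Arguments.
Unset Strict Implicit.
Unset Printing Implicit Defensive.
Import Order.TTheory GRing.Theory Num.Theory.
Import numFieldNormedType.Exports.
Local Open Scope classical_set_scope.
Local Open Scope ring_scope.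

(* The product rule is required for every finite subfamily; [T'] is arbitrary
   so that it also applies to families of pairs. *)
Definition mutually_independent (d d' : measure_display)
    (T : measurableType d) (T' : measurableType d') (R : realType)
    (P : probability T R) (n : nat) (X : 'I_n -> T -> T') : Prop :=
  forall (J : {set 'I_n}) (A : 'I_n -> set T'),
    (forall j, j \in J -> measurable (A j)) ->
    P (\bigcap_(j in [set` J]) (X j @^-1` A j)) =
    (\prod_(j in J) P (X j @^-1` A j))%E.

Section lattice.
Context {R : realType}.
Implicit Types (k : int).

Definition lattice_point (v0 D : R) k : R := v0 + D * k%:~R.

Definition lattice (v0 D : R) : set R := range (lattice_point v0 D).

End lattice.

Section moments.
Context {d : measure_display} {T : measurableType d} {R : realType}.
Implicit Types (P : probability T R) (Y : T -> R).

Definition mean P Y : R := fine 'E_P[Y]%E.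

Definition var P Y : R := fine 'V_P[Y]%E.

(* The supremum is over a nonempty set of reals bounded by 1. *)
Definition normal_distance P Y : R :=
  sup [set `| fine (P [set w | (Y w - mean P Y) / Num.sqrt (var P Y) < x])
             - fine (normal_prob 0 1 `]-oo, x[) | | x in [set: R]].

End moments.

Section bernoulli_part.
Context {d : measure_display} {T : measurableType d} {R : realType}.
Implicit Types (P : probability T R) (k : int).

Definition lattice_mass (v0 D : R) P (X : T -> R) k : R :=
  fine (P [set w | X w = lattice_point v0 D k]).

(* The family is nonnegative and its sum is at most 1. *)
Definition overlap (v0 D : R) P (X : T -> R) : R :=
  fine (\esum_(k in [set: int])
    (Num.min (lattice_mass v0 D P X k) (lattice_mass v0 D P X (k + 1)))%:E).

Definition tau (v0 D : R) P (X : T -> R) (theta : R) k : R :=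
  theta / overlap v0 D P X *
  Num.min (lattice_mass v0 D P X k) (lattice_mass v0 D P X (k + 1)).

Definition is_bernoulli_part (v0 D : R) P (n : nat) (X : 'I_n -> T -> R)
    (theta : 'I_n -> R) (d' : measure_display) (T' : measurableType d')
    (Q : probability T' R) (V eps : 'I_n -> T' -> R) : Prop :=
  [/\ mutually_independent Q (fun j w => (V j w, eps j w)),
      (forall j k, Q [set w | V j w = lattice_point v0 D k /\ eps j w = 1] =
        (tau v0 D P (X j) (theta j) k)%:E)
    & (forall j k, Q [set w | V j w = lattice_point v0 D k /\ eps j w = 0] =
        (lattice_mass v0 D P (X j) k
         - (tau v0 D P (X j) (theta j) (k - 1)
            + tau v0 D P (X j) (theta j) k) / 2)%:E)].

End bernoulli_part.

(* The constant [C0] in the local limit theorem for sums of fair coins. *)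
Definition coin_constant (R : realType) (C0 : R) : Prop :=
  forall (N : nat), (0 < N)%N ->
  forall (d : measure_display) (T : measurableType d) (P : probability T R)
    (b : 'I_N -> {RV P >-> R}),
  mutually_independent P (fun j => b j : T -> R) ->
  (forall j, P [set w | b j w = 0] = (2^-1)%:E /\
             P [set w | b j w = 1] = (2^-1)%:E) ->
  (ereal_sup [set (`| fine (P [set w | \sum_(j < N) b j w = z%:~R])
                  - Num.sqrt (2 / (pi * N%:R))
                    * expR (- (2 * z%:~R - N%:R) ^+ 2 / (2 * N%:R)) |)%:E
             | z in [set: int]]
   <= (C0 * N%:R `^ (- (3 / 2)))%:E)%E.

(* Main.v *)
From HB Require Import structures.
Require Import Defs.
From mathcomp Require Import all_boot all_order all_algebra.
From mathcomp Require Import all_classical all_reals all_analysis.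
From mathcomp Require Import measurable_realfun ring lra.

Set Implicit Arguments.
Unset Strict Implicit.
Unset Printing Implicit Defensive.
Import Order.TTheory GRing.Theory Num.Theory.
Import numFieldNormedType.Exports.
Local Open Scope classical_set_scope.
Local Open Scope ring_scope.

(** Realise X_j as V_j + D eps_j l_j, where the l_j are fair coins independent
    of everything else: adding such a coin on the event eps_j = 1 turns the law
    of V_j back into that of X_j.  Summing over j and writing B for the sum of
    the eps_j,
    $$\mathbb P\{S=\kappa\}=\mathbb E\,b_B\big((\kappa-W)/D\big),$$
    where b_N is the law of the number of heads among N fair coins.  The coins
    need not be constructed on the space of (V, eps): averaging over their
    $2^n$ outcomes l does the same work, and [sum_law] says that the law of S
    is the average of the laws of the sums [coin_sum l].

    The local limit theorem for coins, with constant C0, replaces b_N by the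
    Gaussian $\sqrt{2/(\pi N)}\,e^{-2(\kappa-S')^2/(D^2N)}$, because
    $2(\kappa-W)/D-B=2(\kappa-S')/D$.  By Chernoff's bound [bernoulli_tail], B
    lies within $h\Theta$ of its mean $\Theta$ up to a probability
    $2\Theta^{-3/2}$, if $h^2=6\log\Theta/\Theta$.  Hence N may be replaced by
    $(1\pm h)\Theta$, which squeezes b_B between two Gaussian kernels in
    $\kappa-S'$ with deterministic widths [hitting_weight_squeeze].

    It remains to integrate such a kernel f against the law of S'.  Since f is
    unimodal, replacing S' by a normal variable with the same mean and variance
    costs at most $2H\sup f$ [kolmogorov_unimodal], and the integral of a
    Gaussian kernel against a normal law is explicit [gaussian_convolution].
    The coins contribute the variance $D^2\Theta/4$, so that
    $\mathrm{Var}(S)=\mathrm{Var}(S')+D^2\Theta/4$ [symmetrized_var]: for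
    h = 0 the convolution would be exactly the normal density of S, and for the
    actual h it differs from it by a relative error of order h
    [gaussian_comparison].  The three errors
    $hD/\sqrt{\mathrm{Var}(S)}$, $H/\sqrt\Theta$ and $\Theta^{-3/2}$ are the
    terms of the bound. *)

(** * Deviations of sums of independent Bernoulli variables *)

(** From $e^{-t/2}\ge1-t/2$ one gets $e^t\le(1-t/2)^{-2}$, which is a rational
    function of t. *)
Lemma expR_le_quadratic (R : realType) (t : R) :
  `|t| <= 1 / 3 -> expR t <= 1 + t + t ^+ 2.
Proof.
move=> ht; have /andP[t1 t2] : - (1 / 3) <= t <= 1 / 3 by rewrite -ler_norml.
have h1 : 1 - t / 2 <= expR (- (t / 2)) by exact: expR_ge1Dx.
have h2 : expR t * (expR (- (t / 2)) * expR (- (t / 2))) = 1.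
  by rewrite -!expRD -[RHS](@expR0 R); congr expR; field.
have h3 := expR_gt0 t.
have h4 : (1 - t / 2) * (1 - t / 2) <= expR (- (t / 2)) * expR (- (t / 2)).
  by apply: ler_pM => //; lra.
have h5 : expR t * ((1 - t / 2) * (1 - t / 2)) <= 1.
  by apply: le_trans (ler_wpM2l (ltW h3) h4) _; rewrite h2.
have h6 : 1 <= (1 + t + t ^+ 2) * ((1 - t / 2) * (1 - t / 2)).
  rewrite -subr_ge0.
  have -> : (1 + t + t ^+ 2) * ((1 - t / 2) * (1 - t / 2)) - 1
          = (t ^+ 2 / 4) * (1 - 3 * t + t ^+ 2) by field.
  by apply: mulr_ge0; nra.
rewrite -(@ler_pM2r _ ((1 - t / 2) * (1 - t / 2))); last by nra.
exact: le_trans h5 h6.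
Qed.

(** The joint law of independent Bernoulli variables with parameters theta. *)
Definition bernoulli_weight (R : realType) n (theta : 'I_n -> R)
    (e : {ffun 'I_n -> bool}) : R :=
  \prod_j (if e j then theta j else 1 - theta j).

Lemma bernoulli_weight_ge0 (R : realType) n (theta : 'I_n -> R) e :
  (forall j, 0 <= theta j <= 1) -> 0 <= bernoulli_weight theta e.
Proof.
by move=> h; apply: prodr_ge0 => j _; have := h j; case: ifP => _ /andP[]; lra.
Qed.

Lemma bernoulli_mgf_le (R : realType) n (theta : 'I_n -> R) (t : R) :
  (forall j, 0 <= theta j <= 1) ->
  \sum_(e : {ffun 'I_n -> bool})
      bernoulli_weight theta e * expR (t * \sum_j (e j)%:R)
  <= expR ((\sum_j theta j) * (expR t - 1)).
Proof.
move=> h.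
have -> : \sum_(e : {ffun 'I_n -> bool})
      bernoulli_weight theta e * expR (t * \sum_j (e j)%:R)
    = \prod_j \sum_(b : bool) (if b then theta j * expR t else 1 - theta j).
  rewrite bigA_distr_bigA /=; apply: eq_bigr => e _.
  rewrite mulr_sumr expR_sum /bernoulli_weight -big_split /=.
  by apply: eq_bigr => j _; case: (e j); rewrite ?mulr1 // mulr0 expR0 mulr1.
rewrite mulr_suml expR_sum; apply: ler_prod => j _.
rewrite big_bool /=; have /andP[h0 h1] := h j.
have := expR_gt0 t => et.
apply/andP; split; first by nra.
apply: le_trans (expR_ge1Dx _); lra.
Qed.

(** Chernoff's bound, from $\mathbb E e^{tB}\le e^{\Theta(e^t-1)}$ and
    $e^t-1-t\le t^2$: the choice t = h / 2 for the upper tail and t = - h / 2 for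
    the lower one minimises the resulting exponent $\Theta(t^2-|t|h)$. *)
Lemma bernoulli_tail (R : realType) n (theta : 'I_n -> R) (h : R) :
  (forall j, 0 <= theta j <= 1) -> 0 <= h <= 2 / 3 ->
  \sum_(e : {ffun 'I_n -> bool}
       | h * (\sum_j theta j) < `|\sum_j (e j)%:R - \sum_j theta j|)
     bernoulli_weight theta e <= 2 * expR (- ((\sum_j theta j) * h ^+ 2 / 4)).
Proof.
move=> hth /andP[h0 h1]; set Theta := \sum_j theta j.
have Theta0 : 0 <= Theta by apply: sumr_ge0 => j _; case/andP: (hth j).
have w0 e : 0 <= bernoulli_weight theta e by exact: bernoulli_weight_ge0.
pose E (t : R) := \sum_(e : {ffun 'I_n -> bool}) bernoulli_weight theta e
   * expR (t * \sum_j (e j)%:R) * expR (- (t * Theta) - h / 2 * h * Theta).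
have EE t : `|t| <= 1 / 3 -> t ^+ 2 = (h / 2) ^+ 2 ->
    E t <= expR (- (Theta * h ^+ 2 / 4)).
  move=> ht htt; rewrite /E -mulr_suml.
  apply: le_trans (_ : expR (Theta * (expR t - 1))
     * expR (- (t * Theta) - h / 2 * h * Theta) <= _).
    by rewrite ler_wpM2r ?expR_ge0 // bernoulli_mgf_le.
  rewrite -expRD ler_expR.
  have := expR_le_quadratic ht; rewrite htt => hq.
  nra.
have -> : 2 * expR (- (Theta * h ^+ 2 / 4)) =
  expR (- (Theta * h ^+ 2 / 4)) + expR (- (Theta * h ^+ 2 / 4)) by ring.
apply: le_trans (_ : E (h / 2) + E (- (h / 2)) <= _); last first.
  by apply: lerD; apply: EE; rewrite ?sqrrN // ?normrN ger0_norm; lra.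
(* bound the indicator of the event by the sum of the two exponentials *)
rewrite /E -big_split /= big_mkcond; apply: ler_sum => e _.
set w := bernoulli_weight theta e; set s := \sum_j _.
have := w0 e; rewrite -/w => wge0.
have key t u : w * expR (t * s) * expR u = w * expR (t * s + u).
  by rewrite expRD mulrA.
rewrite !key -mulrDr.
have p1 := expR_gt0 (h / 2 * s + (- (h / 2 * Theta) - h / 2 * h * Theta)).
have p2 := expR_gt0 (- (h / 2) * s + (- (- (h / 2) * Theta) - h / 2 * h * Theta)).
case: ifPn => [|_]; last by apply: mulr_ge0 => //; apply: addr_ge0; exact: ltW.
rewrite ltr_normr => /orP[]hs; rewrite -[X in X <= _]mulr1 ler_wpM2l //.
- apply: le_trans (_ : expR (h / 2 * s + (- (h / 2 * Theta) - h / 2 * h * Theta)) <= _);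
    last by rewrite lerDl ltW.
  by rewrite -[X in X <= _](@expR0 R) ler_expR; nra.
- apply: le_trans (_ : expR (- (h / 2) * s + (- (- (h / 2) * Theta) - h / 2 * h * Theta)) <= _);
    last by rewrite lerDr ltW.
  by rewrite -[X in X <= _](@expR0 R) ler_expR; nra.
Qed.

(** * Convolution of Gaussian kernels with the normal law *)

(** The Radon-Nikodym derivative of the normal law agrees almost everywhere with
    its density, both having the same integral over every measurable set. *)
Lemma ge0_integral_normal_prob (R : realType) (m s : R) (f : R -> R) :
  measurable_fun [set: R] f -> (forall x, 0 <= f x) ->
  (\int[normal_prob m s]_x (f x)%:E
   = \int[lebesgue_measure]_x (f x * normal_pdf m s x)%:E)%E.
Proof.
move=> mf f0.
have dom := normal_prob_dominates m s.
have mpdf := measurable_normal_pdf m s.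
rewrite -(Radon_Nikodym_SigmaFinite.change_of_variables dom) //; last first.
  exact/measurable_EFinP.
have mf' := measurable_int _ (Radon_Nikodym_SigmaFinite.f_integrable dom).
apply: ae_eq_integral => //.
- by apply: emeasurable_funM => //; exact/measurable_EFinP.
- by apply/measurable_EFinP; exact: measurable_funM.
under [X in ae_eq _ _ _ X]eq_fun do rewrite EFinM.
apply: ae_eqe_mul2l; apply: integral_ae_eq => //.
- exact: Radon_Nikodym_SigmaFinite.f_integrable.
- exact/measurable_EFinP.
- by move=> A _ mA; rewrite -(Radon_Nikodym_SigmaFinite.f_integral dom).
Qed.

Lemma complete_square (R : realFieldType) (a sigma s x : R) : 0 < s ->
  - (a - sigma * x) ^+ 2 / (2 * s ^+ 2) + - x ^+ 2 / (1 * 2)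
  = - a ^+ 2 / (2 * (s ^+ 2 + sigma ^+ 2))
    + - (x - a * sigma / (s ^+ 2 + sigma ^+ 2)) ^+ 2
        / (s ^+ 2 / (s ^+ 2 + sigma ^+ 2) * 2).
Proof.
move=> s0; have hv : s ^+ 2 + sigma ^+ 2 != 0.
  by rewrite gt_eqF // ltr_pwDl ?sqr_ge0 // exprn_gt0.
have hs : s != 0 by rewrite gt_eqF.
by field; rewrite hs hv.
Qed.

(** Complete the square: up to a constant, the integrand times the standard
    normal density is the normal density with mean
    $a\sigma/(s^2+\sigma^2)$ and variance $s^2/(s^2+\sigma^2)$. *)
Lemma gaussian_convolution (R : realType) (a sigma s : R) : 0 < s ->
  (\int[normal_prob 0 1]_x (expR (- (a - sigma * x) ^+ 2 / (2 * s ^+ 2)))%:E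
   = (s / Num.sqrt (s ^+ 2 + sigma ^+ 2)
      * expR (- a ^+ 2 / (2 * (s ^+ 2 + sigma ^+ 2))))%:E)%E.
Proof.
move=> s0.
have v0 : 0 < s ^+ 2 + sigma ^+ 2.
  by rewrite ltr_pwDl ?sqr_ge0 // exprn_gt0.
set v := s ^+ 2 + sigma ^+ 2 in v0 *.
have sv0 : 0 < Num.sqrt v by rewrite sqrtr_gt0.
pose t := s / Num.sqrt v.
have t0 : 0 < t by rewrite divr_gt0.
have tsq : t ^+ 2 = s ^+ 2 / v by rewrite expr_div_n sqr_sqrtr // ltW.
rewrite ge0_integral_normal_prob; last 2 first.
- apply: measurableT_comp => //; apply: measurable_funM => //.
  apply: measurableT_comp => //; apply: measurable_funX.
  by apply: measurable_funB => //; exact: measurable_funM.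
- by move=> x; exact: expR_ge0.
transitivity (\int[lebesgue_measure]_x
  ((t * expR (- a ^+ 2 / (2 * v)))%:E
    * (normal_pdf (a * sigma / v) t x)%:E))%E.
  apply: eq_integral => x _; rewrite -EFinM; congr EFin.
  rewrite !normal_pdfE ?gt_eqF //.
  have pk : normal_peak 1 = t * normal_peak t.
    rewrite /normal_peak expr1n mul1r -mulrnAr sqrtrM ?sqr_ge0 //.
    by rewrite sqrtr_sqr gtr0_norm // invfM mulrA mulfV ?gt_eqF // mul1r.
  rewrite pk [LHS]mulrCA [RHS]mulrACA; congr (_ * _).
  rewrite /normal_fun -!expRD; congr expR.
  rewrite -(mulr_natr (t ^+ 2)) -(mulr_natr (1 ^+ 2)) tsq subr0 expr1n.
  exact: complete_square.
rewrite ge0_integralZl //.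
- by rewrite integral_normal_pdf mule1.
- by apply/measurable_EFinP; exact: measurable_normal_pdf.
- by move=> x _; rewrite lee_fin normal_pdf_ge0.
- by rewrite lee_fin mulr_ge0 ?expR_ge0 // ltW.
Qed.

(** * Kolmogorov distance and unimodal functions *)

Section kolmogorov.
Context {R : realType} (mu nu : probability (measurableTypeR R) R) (H : R).
Hypothesis muH : forall x,
  `|fine (mu `]-oo, x[%classic) - fine (nu `]-oo, x[%classic)| <= H.

(** The hypothesis covers open half-lines; a closed one is a decreasing limit of
    open ones. *)
Let mu_nu_left (b : itv_bound R) :
  `|fine (mu [set` Interval -oo%O b]) - fine (nu [set` Interval -oo%O b])| <= H.
Proof.
have H0 : 0 <= H by apply: le_trans (muH 0).
case: b => [[] x|[]].
- exact: muH.
- have cv (m : probability (measurableTypeR R) R) :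
    fine (m `]-oo, (x + k.+1%:R^-1)[%classic) @[k --> \oo]
      --> fine (m `]-oo, x]%classic).
    apply: fine_cvg; rewrite fineK ?fin_num_measure //.
    rewrite (_ : `]-oo, x]%classic
        = \bigcap_k `]-oo, (x + k.+1%:R^-1)[%classic); last first.
      apply/seteqP; split => y /=; rewrite ?in_itv /=.
        by move=> yx k _ /=; rewrite in_itv /= (le_lt_trans yx) // ltrDl.
      move=> h; rewrite ?in_itv /=; apply/ler_addgt0Pr => e e0.
      have [k ke] := ltr_add_invr e0.
      have := h k I; rewrite /= in_itv /= => /ltW /le_trans; apply.
      by rewrite lerD2l; move: ke; rewrite !add0r => /ltW.
    apply: nonincreasing_cvg_mu => //.
    + by rewrite (le_lt_trans (probability_le1 _ _)) ?ltry.
    + exact: bigcap_measurable.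
    + move=> k l kl; apply/subsetPset => y /=; rewrite !in_itv /= => /lt_le_trans.
      by apply; rewrite lerD2l lef_pV2 ?posrE // ler_nat.
  apply: (cvgr_to_le (cvg_norm (cvgB (cv mu) (cv nu)))).
  by near=> k; exact: muH.
- have -> : [set` Interval (-oo%O : itv_bound R) -oo%O] = set0.
    by rewrite set_itvE.
  by rewrite !measure0 subrr normr0.
- by rewrite set_itv_infty_infty !probability_setT subrr normr0.
Unshelve. all: by end_near. Qed.

(** An interval is the difference of two half-lines, whence the factor 2. *)
Lemma kolmogorov_interval (I : set R) : is_interval I ->
  `|fine (mu I) - fine (nu I)| <= 2 * H.
Proof.
have H0 : 0 <= H by apply: le_trans (muH 0).
move=> /is_intervalP ->; case: (Rhull I) => a b.
have [ab|ba] := leP a b; last first.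
  rewrite set_itv_ge ?measure0 ?subrr ?normr0 ?mulr_ge0 //.
  by rewrite -leNgt ltW.
have itvE (m : probability (measurableTypeR R) R) :
   fine (m [set` Interval a b]) =
     fine (m [set` Interval -oo%O b]) - fine (m [set` Interval -oo%O a]).
  rewrite (@itv_bndbnd_setU _ _ -oo%O a b) //.
  rewrite measureU //; first by rewrite fineD ?fin_num_measure // addrC addKr.
  apply/seteqP; split => // x /= [] /andP[_ xa] /andP[ax _].
  by have := le_trans xa ax; rewrite bnd_simp ltxx.
rewrite !itvE.
have := mu_nu_left a; have := mu_nu_left b.
set x := fine _; set y := fine _; set z := fine _; set t := fine _.
rewrite !ler_norml => /andP[? ?] /andP[? ?]; apply/andP; split; lra.
Qed.

(** Layer cake: $\int f\,d\mu=\int_0^1\mu\{f>r\}\,dr$, and the superlevel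
    sets of a unimodal function are intervals. *)
Lemma kolmogorov_unimodal (f : R -> R) : measurable_fun [set: R] f ->
  (forall y, 0 <= f y <= 1) -> (forall r, is_interval [set y | r < f y]) ->
  (\int[mu]_y (f y)%:E <= \int[nu]_y (f y)%:E + (2 * H)%:E)%E.
Proof.
move=> mf f01 fitv.
have H0 : 0 <= H by apply: le_trans (muH 0).
have f0 y : 0 <= f y by case/andP: (f01 y).
pose isf := isMeasurableFun.Build _ _ (measurableTypeR R) R f mf.
pose F : {mfun (measurableTypeR R) >-> R} := HB.pack f isf.
have layer (m : probability (measurableTypeR R) R) :
    (\int[m]_y (f y)%:E
     = \int[lebesgue_measure]_(r in `[0%R, +oo[) m [set y : R | (r < f y)%R])%E.
  have := @ge0_expectation_ccdf _ _ _ m F f0.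
  rewrite unlock => ->; apply: eq_integral => r _.
  rewrite /ccdf /distribution /pushforward; congr (m _).
  by apply/seteqP; split => y /=; rewrite in_itv /= andbT.
have mccdf (m : probability (measurableTypeR R) R) :
    measurable_fun [set: R] (fun r => m [set y | r < f y]).
  have := @ccdf_measurable _ _ _ m F.
  apply: eq_measurable_fun => r _.
  rewrite /ccdf /distribution /pushforward; congr (m _).
  by apply/seteqP; split => y /=; rewrite in_itv /= andbT.
rewrite !layer.
have -> : (2 * H)%:E
    = (\int[lebesgue_measure]_(r in `[0%R, +oo[) (2 * H * \1_(`[0%R, 1%R]%classic) r)%:E)%E.
  under eq_integral do rewrite EFinM.
  rewrite ge0_integralZl //.
  - rewrite integral_indic // (_ : _ `&` _ = `[0%R, 1%R]%classic).
      rewrite [X in (_ * X)%E](_ : _ = 1%E) ?mule1 //.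
      apply: etrans (lebesgue_measure_itv `[0%R, 1%R]) _.
      by rewrite /= lte01 oppr0 adde0.
    apply: setIidl => r /=; rewrite !in_itv /= => /andP[-> _] //.
  - by apply/measurable_EFinP; exact: measurable_indic.
  - by rewrite lee_fin mulr_ge0.
have mind : measurable_fun [set: R] (fun r => (2 * H * \1_(`[0%R, 1%R]%classic) r)%:E).
  by apply/measurable_EFinP; apply: measurable_funM => //; exact: measurable_indic.
rewrite -ge0_integralD //.
- apply: ge0_le_integral => //.
  + exact: measurable_funTS (mccdf _).
  + apply: emeasurable_funD; first exact: measurable_funTS (mccdf _).
    exact: measurable_funTS mind.
  + move=> r /=; rewrite in_itv /= andbT => r0.
    have [r1|r1] := leP r 1.
      rewrite indicE mem_set /= ?in_itv /= ?r0 ?r1 // mulr1.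
      have mr (m : probability (measurableTypeR R) R) :
        m [set y | r < f y] = (fine (m [set y | r < f y]))%:E.
        rewrite fineK // fin_num_measure //.
        rewrite -[X in measurable X]setTI.
        rewrite (_ : [set y | r < f y] = f @^-1` `]r, +oo[); first exact: (mf measurableT _ (measurable_itv _)).
        by apply/seteqP; split => y /=; rewrite in_itv /= andbT.
      rewrite (mr mu) (mr nu) -EFinD lee_fin.
      have := kolmogorov_interval (fitv r).
      by rewrite ler_norml lerBlDl => /andP[_].
    rewrite (_ : [set y | r < f y] = set0) ?measure0 ?add0e.
      by rewrite lee_fin mulr_ge0 ?mulr_ge0 // indicE.
    apply/seteqP; split => // y /=; have /andP[_ f1] := f01 y.
    by move=> /lt_le_trans/(_ (le_trans f1 (ltW r1))); rewrite ltxx.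
- exact: measurable_funTS (mccdf _).
- by move=> r _; rewrite lee_fin mulr_ge0 ?mulr_ge0 // indicE.
- exact: measurable_funTS mind.
Qed.

End kolmogorov.

Lemma varE (d : measure_display) (T : measurableType d) (R : realType)
    (P : probability T R) (Z : T -> R) :
  var P Z = fine (\int[P]_w ((Z w - mean P Z) ^+ 2)%:E)%E.
Proof.
rewrite /var /mean /variance covariance.unlock expectation.unlock; congr fine.
Qed.

Section normal_distance_lemmas.
Context {d : measure_display} {T : measurableType d} {R : realType}.
Variables (Q : probability T R) (Z : T -> R).
Hypotheses (mZ : measurable_fun [set: T] Z).

Let m := mean Q Z.
Let v := var Q Z.
Let H := normal_distance Q Z.
Let Y w := (Z w - m) / Num.sqrt v.

Let mY : measurable_fun [set: T] Y.
Proof. by apply: measurable_funM => //; exact: measurable_funB. Qed.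

Let fine_prob01 d1 (T1 : measurableType d1) (P : probability T1 R) A :
  measurable A -> 0 <= fine (P A) <= 1.
Proof.
move=> mA; rewrite fine_ge0 //= -lee_fin fineK ?fin_num_measure //.
exact: probability_le1.
Qed.

Lemma normal_distance_ge x :
  `|fine (Q (Y @^-1` `]-oo, x[)) - fine (normal_prob 0 1 `]-oo, x[)| <= H.
Proof.
have YE y : Y @^-1` `]-oo, y[ = [set w | (Z w - m) / Num.sqrt v < y].
  by apply/seteqP; split => w /=; rewrite in_itv.
apply: ub_le_sup; last by exists x; rewrite ?YE.
exists 1 => _ [y _ <-]; rewrite -YE.
have mYy := mY measurableT (measurable_itv `]-oo, y[).
rewrite setTI in mYy.
have /andP[? ?] := fine_prob01 Q mYy.
have /andP[? ?] := fine_prob01 (normal_prob 0 1) (measurable_itv `]-oo, y[).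
by rewrite ler_norml; apply/andP; split; lra.
Qed.

Lemma normal_distance_ge0 : 0 <= H.
Proof. by apply: le_trans (normal_distance_ge 0). Qed.

Hypothesis Z2 : (\int[Q]_w ((Z w - m) ^+ 2)%:E < +oo)%E.

Let vE : v%:E = (\int[Q]_w ((Z w - m) ^+ 2)%:E)%E.
Proof.
rewrite /v varE fineK // ge0_fin_numE //.
by apply: integral_ge0 => w _; rewrite lee_fin sqr_ge0.
Qed.

Lemma var_ge0 : 0 <= v.
Proof.
by rewrite -lee_fin vE; apply: integral_ge0 => w _; rewrite lee_fin sqr_ge0.
Qed.

(** If v = 0, then Y is identically zero by the convention on division, but Z is
    almost surely constant, so that the identity survives; this is why a
    degenerate Z needs no separate treatment below. *)
Let ZY : {ae Q, forall w, Z w = m + Num.sqrt v * Y w}.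
Proof.
have [v0|v0] := eqVneq v 0; last first.
  apply: aeW => w; rewrite /Y mulrCA mulfV ?mulr1 ?subrKC //.
  by rewrite sqrtr_eq0 -ltNge lt_neqAle eq_sym v0 var_ge0.
have : ae_eq Q setT (fun w => ((Z w - m) ^+ 2)%:E) (cst 0%E).
  apply/ae_eq_integral_abs => //.
    by apply/measurable_EFinP; apply: measurable_funX; exact: measurable_funB.
  under eq_integral do rewrite gee0_abs ?lee_fin ?sqr_ge0 //.
  by rewrite -vE v0.
apply: filterS => w /(_ I) /= [/eqP]; rewrite sqrf_eq0 subr_eq0 => /eqP ->.
by rewrite v0 sqrtr0 mul0r addr0.
Qed.

(** As a function of Y the integrand is unimodal with values in [0, 1], so that Y
    can be replaced by a standard normal variable at the cost of 2 H. *)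
Lemma gaussian_smoothing (a s : R) : 0 < s ->
  `|fine (\int[Q]_w (expR (- (a - Z w) ^+ 2 / (2 * s ^+ 2)))%:E)%E
    - s / Num.sqrt (s ^+ 2 + v) * expR (- (a - m) ^+ 2 / (2 * (s ^+ 2 + v)))|
  <= 2 * H.
Proof.
move=> s0.
pose f (y : R) : R := expR (- ((a - m) - Num.sqrt v * y) ^+ 2 / (2 * s ^+ 2)).
have mf : measurable_fun [set: R] f.
  apply: measurableT_comp => //; apply: measurable_funM => //.
  apply: measurableT_comp => //; apply: measurable_funX.
  by apply: measurable_funB => //; exact: measurable_funM.
have s2 : 0 < 2 * s ^+ 2 by rewrite mulr_gt0 // exprn_gt0.
have f01 y : 0 <= f y <= 1.
  rewrite expR_ge0 /= -[X in _ <= X](@expR0 R) ler_expR mulNr oppr_le0.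
  by rewrite divr_ge0 ?sqr_ge0 // ltW.
have fitv r : is_interval [set y | r < f y].
  move=> x y /= rx ry z /andP[xz zy].
  have sv := sqrtr_ge0 v.
  (* a quadratic is at most its value at one of two surrounding points *)
  have cvx : ((a - m) - Num.sqrt v * z) ^+ 2 <= ((a - m) - Num.sqrt v * x) ^+ 2
      \/ ((a - m) - Num.sqrt v * z) ^+ 2 <= ((a - m) - Num.sqrt v * y) ^+ 2.
    have h1 : Num.sqrt v * x <= Num.sqrt v * z by rewrite ler_wpM2l // ltW.
    have h2 : Num.sqrt v * z <= Num.sqrt v * y by rewrite ler_wpM2l // ltW.
    by have [h|h] := leP 0 ((a - m) - Num.sqrt v * z); [left|right]; nra.
  by case: cvx => h; [apply: lt_le_trans rx _|apply: lt_le_trans ry _];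
    rewrite ler_expR !mulNr lerN2 ler_wpM2r // invr_ge0 ltW.
pose isY := isMeasurableFun.Build _ _ T (measurableTypeR R) Y mY.
pose Y' : {mfun T >-> measurableTypeR R} := HB.pack Y isY.
have EQ : (\int[Q]_w (expR (- (a - Z w) ^+ 2 / (2 * s ^+ 2)))%:E
           = \int[distribution Q Y']_y (f y)%:E)%E.
  rewrite ge0_integral_distribution //; last first.
  - by move=> y; rewrite lee_fin expR_ge0.
  - exact/measurable_EFinP.
  apply: ae_eq_integral => //.
  - apply/measurable_EFinP; apply: measurableT_comp => //.
    apply: measurable_funM => //; apply: measurableT_comp => //.
    by apply: measurable_funX; exact: measurable_funB.
  - by apply/measurable_EFinP; exact: measurableT_comp.
  apply: filterS ZY => w -> _ /=.
  by rewrite /f opprD addrA.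
rewrite EQ.
have EN := gaussian_convolution (a - m) (Num.sqrt v) s0.
rewrite sqr_sqrtr ?var_ge0 // in EN.
have dH x := normal_distance_ge x.
have up := @kolmogorov_unimodal R (distribution Q Y') (normal_prob 0 1) H
  dH f mf f01 fitv.
have lo := @kolmogorov_unimodal R (normal_prob 0 1) (distribution Q Y') H
  (fun x => eq_ind _ (fun z => z <= H) (dH x) _ (distrC _ _)) f mf f01 fitv.
rewrite EN in up; rewrite EN in lo.
have fin : (\int[distribution Q Y']_y (f y)%:E)%E \is a fin_num.
  rewrite ge0_fin_numE; first by apply: le_lt_trans up _; rewrite -EFinD ltry.
  by apply: integral_ge0 => y _; rewrite lee_fin expR_ge0.
move: up lo; rewrite -(fineK fin) -!EFinD !lee_fin => up lo.
by rewrite ler_norml; apply/andP; split; lra.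
Qed.

End normal_distance_lemmas.

(** * Elementary estimates *)

Lemma sqrt_expR (R : realType) (T : R) : 0 < T -> Num.sqrt T = expR (ln T / 2).
Proof.
move=> T0; rewrite -{1}(lnK T0) [X in expR X](_ : ln T = ln T / 2 + ln T / 2); last by field.
by rewrite expRD -expr2 sqrtr_sqr gtr0_norm // expR_gt0.
Qed.

Lemma expR_three_halves (R : realType) (T : R) : 0 < T ->
  expR (- (3 / 2 * ln T)) = (T * Num.sqrt T)^-1.
Proof.
move=> T0; rewrite sqrt_expR // -{2}(lnK T0) -expRD -expRN.
by congr expR; field.
Qed.

Lemma powR_three_halves_le (R : realType) (T N : R) : 0 < T -> T / 3 <= N ->
  N `^ (- (3 / 2)) <= 6 / (T * Num.sqrt T).
Proof.
move=> T0 TN; have N0 : 0 < N by apply: lt_le_trans TN; rewrite divr_gt0.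
have tT : 0 < Num.sqrt T by rewrite sqrtr_gt0.
have tN : 0 < Num.sqrt N by rewrite sqrtr_gt0.
rewrite /powR gt_eqF // mulNr expR_three_halves //.
rewrite ler_pdivlMr ?mulr_gt0 // ler_pdivrMl ?mulr_gt0 //.
have h1 : Num.sqrt T <= 2 * Num.sqrt N.
  rewrite -[2 * _]ger0_norm ?mulr_ge0 // -sqrtr_sqr exprMn sqr_sqrtr; last exact: ltW.
  by rewrite ler_wsqrtr //; lra.
by nra.
Qed.

(** $e^{-u}-e^{-u(1+h)}\le e^{-u}uh\le h$. *)
Lemma expR_damping_le (R : realType) (u h : R) :
  0 <= u -> 0 <= h -> expR (- u) <= expR (- (u * (1 + h))) + h.
Proof.
move=> u0 h0.
have e1 : expR (- u) * (1 + u) <= 1.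
  rewrite -[X in _ <= X](@expR0 R) -(addNr u) expRD ler_wpM2l ?expR_ge0 //.
  exact: expR_ge1Dx.
have e2 : 1 - u * h <= expR (- (u * h)) by exact: expR_ge1Dx.
have -> : expR (- (u * (1 + h))) = expR (- u) * expR (- (u * h)).
  by rewrite -expRD; congr expR; ring.
have := expR_gt0 (- u) => e0.
have : expR (- u) * (1 - u * h) <= expR (- u) * expR (- (u * h)).
  by rewrite ler_wpM2l // ltW.
nra.
Qed.

Lemma sqrt_ratio_le (R : realType) (h : R) : 0 <= h <= 2 / 3 ->
  Num.sqrt (1 + h) <= (1 + 3 * h) * Num.sqrt (1 - h).
Proof.
move=> /andP[h0 h1].
rewrite -[X in X * _]ger0_norm; last by lra.
rewrite -sqrtr_sqr -sqrtrM ?sqr_ge0 // ler_wsqrtr //.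
have : 0 <= h * (4 + 3 * h - 9 * h ^+ 2) by apply: mulr_ge0 => //; nra.
by lra.
Qed.

Lemma sqrt_ratio_ge (R : realType) (h : R) : 0 <= h <= 2 / 3 ->
  (1 - h) * Num.sqrt (1 + h) <= Num.sqrt (1 - h).
Proof.
move=> /andP[h0 h1].
rewrite -[X in X * _]ger0_norm; last by lra.
rewrite -sqrtr_sqr -sqrtrM ?sqr_ge0 // ler_wsqrtr //.
have : 0 <= h * (h * (1 - h)) by rewrite !mulr_ge0 //; lra.
by lra.
Qed.

Lemma expR_larger_variance_le (R : realType) (V V1 y h : R) : 0 < V -> 0 < V1 ->
  0 <= h -> V1 <= (1 + h) * V ->
  expR (- y ^+ 2 / (2 * V1)) <= expR (- (y ^+ 2 / (2 * V))) + h.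
Proof.
move=> V0 V10 h0 V1V; have h1 : 0 < 1 + h by lra.
have w0 : 0 <= y ^+ 2 / (2 * V) / (1 + h).
  by rewrite !divr_ge0 ?sqr_ge0 ?mulr_ge0 // ltW.
have := expR_damping_le w0 h0; rewrite divfK ?gt_eqF //; apply: le_trans.
rewrite ler_expR mulNr lerN2 -mulrA -invfM; apply: ler_wpM2l; first exact: sqr_ge0.
by rewrite lef_pV2 ?posrE ?mulr_gt0 //; lra.
Qed.

Lemma expR_smaller_variance_ge (R : realType) (V V2 y h : R) : 0 < V -> 0 < V2 ->
  0 <= h < 1 -> (1 - h) * V <= V2 ->
  expR (- (y ^+ 2 / (2 * V))) <= expR (- y ^+ 2 / (2 * V2)) + h / (1 - h).
Proof.
move=> V0 V20 /andP[h0 h1] V2V; have h1' : 0 < 1 - h by lra.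
have u0 : 0 <= y ^+ 2 / (2 * V) by rewrite !divr_ge0 ?sqr_ge0 ?mulr_ge0 // ltW.
have h0' : 0 <= h / (1 - h) by rewrite divr_ge0 // ltW.
have := expR_damping_le u0 h0'.
move=> /le_trans; apply; rewrite lerD2r ler_expR mulNr lerN2.
have -> : 1 + h / (1 - h) = (1 - h)^-1 by field; rewrite gt_eqF.
rewrite -mulrA -invfM; apply: ler_wpM2l; first exact: sqr_ge0.
by rewrite lef_pV2 ?posrE ?mulr_gt0 //; lra.
Qed.

Lemma peak_ratio_le (R : rcfType) (D p a b t V V1 r : R) :
  0 < D -> 0 < p -> 0 < a -> 0 < b -> 0 < t -> 0 < V -> V <= V1 -> b <= r * a ->
  2 / (p * a * t) * (D / 2 * (b * t) / Num.sqrt V1) <= D / Num.sqrt V / p * r.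
Proof.
move=> D0 p0 a0 b0 t0 V0 VV1 bra.
have V10 : 0 < V1 by exact: lt_le_trans VV1.
have sV : 0 < Num.sqrt V by rewrite sqrtr_gt0.
have sV1 : 0 < Num.sqrt V1 by rewrite sqrtr_gt0.
have -> : 2 / (p * a * t) * (D / 2 * (b * t) / Num.sqrt V1)
    = D / p * (b / a) * (Num.sqrt V1)^-1 by field; rewrite !gt_eqF.
have -> : D / Num.sqrt V / p * r = D / p * r * (Num.sqrt V)^-1 by ring.
have br : b / a <= r by rewrite ler_pdivrMr.
apply: ler_pM; rewrite ?invr_ge0 ?sqrtr_ge0 //.
- by rewrite !mulr_ge0 ?invr_ge0 // ltW.
- by rewrite ler_pM2l ?divr_gt0.
- by rewrite lef_pV2 ?posrE // ler_wsqrtr.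
Qed.

Lemma peak_ratio_ge (R : rcfType) (D p a b t V V2 r : R) :
  0 < D -> 0 < p -> 0 < a -> 0 < b -> 0 < t -> 0 < V2 -> V2 <= V -> 0 <= r ->
  r * b <= a ->
  D / Num.sqrt V / p * r <= 2 / (p * b * t) * (D / 2 * (a * t) / Num.sqrt V2).
Proof.
move=> D0 p0 a0 b0 t0 V20 V2V r0 rba.
have V0 : 0 < V by exact: lt_le_trans V2V.
have sV : 0 < Num.sqrt V by rewrite sqrtr_gt0.
have sV2 : 0 < Num.sqrt V2 by rewrite sqrtr_gt0.
have -> : 2 / (p * b * t) * (D / 2 * (a * t) / Num.sqrt V2)
    = D / p * (a / b) * (Num.sqrt V2)^-1 by field; rewrite !gt_eqF.
have -> : D / Num.sqrt V / p * r = D / p * r * (Num.sqrt V)^-1 by ring.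
have br : r <= a / b by rewrite ler_pdivlMr.
apply: ler_pM; rewrite ?invr_ge0 ?sqrtr_ge0 //.
- by rewrite !mulr_ge0 ?invr_ge0 // ltW.
- by rewrite ler_pM2l ?divr_gt0.
- by rewrite lef_pV2 ?posrE // ler_wsqrtr.
Qed.

(** Here A is the height of the smoothed kernel and E1 its exponential factor,
    c and E those of the target density; m is the maximum of the kernel. *)
Lemma upper_combination (R : realFieldType) (c A E E1 h m H g : R) :
  0 <= c -> 0 <= h <= 2 / 3 -> 0 <= E <= 1 -> 0 <= E1 -> 0 <= A ->
  A <= c * (1 + 3 * h) -> E1 <= E + h -> m * (2 * H) <= g ->
  A * E1 + m * (2 * H) <= c * E + c * (6 * h) + g.
Proof.
move=> c0 /andP[h0 h1] /andP[E0 E1'] E10 A0 Ac EE mg; apply: lerD => //.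
have h3 : 0 <= 1 + 3 * h by lra.
apply: (@le_trans _ _ (c * (1 + 3 * h) * (E + h))).
  by apply: ler_pM.
rewrite -mulrA -mulrDr ler_wpM2l //; nra.
Qed.

Lemma lower_combination (R : realFieldType) (c A E E2 h m H g : R) :
  0 <= c -> 0 <= h <= 2 / 3 -> 0 <= E <= 1 -> 0 <= E2 ->
  c * (1 - h) <= A -> E <= E2 + h / (1 - h) -> m * (2 * H) <= g ->
  c * E <= A * E2 - m * (2 * H) + c * (6 * h) + g.
Proof.
move=> c0 /andP[h0 h1] /andP[E0 E1'] E20 Ac EE mg.
have h3 : 0 < 1 - h by lra.
have k1 : c * (1 - h) * E2 <= A * E2 by rewrite ler_wpM2r.
have k2 : (1 - h) * E <= (1 - h) * E2 + h.
  have -> : (1 - h) * E2 + h = (1 - h) * (E2 + h / (1 - h)).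
    by field; rewrite gt_eqF.
  by rewrite ler_pM2l.
have k3 : c * E <= c * ((1 - h) * E2 + 6 * h).
  rewrite ler_wpM2l //; nra.
lra.
Qed.

(** The kernels with standard deviations s1 and s2 majorise and minorise the
    coin probabilities; V1 and V2 are the variances after convolution with a
    normal law of variance $V-D^2T/4$.  Replacing V1 and V2 by V in the
    smoothed kernels, and 1 - h and 1 + h by 1 in their heights, costs a relative
    error of order h, which is a multiple of $\sqrt{\log T/T}$. *)
Lemma gaussian_comparison (R : realType) (T D V y H h C1 : R) :
  1 < T -> 0 < D -> D ^+ 2 * T / 4 <= V -> 0 <= H -> 0 <= C1 ->
  0 <= h <= 2 / 3 -> h ^+ 2 = 6 * (ln T / T) ->
  let s1 := D / 2 * Num.sqrt ((1 + h) * T) in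
  let s2 := D / 2 * Num.sqrt ((1 - h) * T) in
  let V1 := s1 ^+ 2 + (V - D ^+ 2 * T / 4) in
  let V2 := s2 ^+ 2 + (V - D ^+ 2 * T / 4) in
  let err := 6 * C1 / (T * Num.sqrt T) + 2 / (T * Num.sqrt T) in
  let q := D * expR (- y ^+ 2 / (2 * V)) / Num.sqrt (2 * pi * V) in
  let bound := 12 * (C1 + 1) * (D * Num.sqrt (ln T / (V * T))
                                + (H + T^-1) / Num.sqrt T) in
  Num.sqrt (2 / (pi * ((1 - h) * T)))
    * (s1 / Num.sqrt V1 * expR (- y ^+ 2 / (2 * V1)) + 2 * H) + err <= q + bound
  /\ q <= Num.sqrt (2 / (pi * ((1 + h) * T)))
    * (s2 / Num.sqrt V2 * expR (- y ^+ 2 / (2 * V2)) - 2 * H) - err + bound.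
Proof.
move=> T1 D0 VT H0 C0 h023 hT s1 s2 V1 V2 err q bound.
have /andP[h0 h23] := h023.
have h1m : 0 < 1 - h by lra.
have h1p : 0 < 1 + h by lra.
pose p := Num.sqrt (2 * pi : R).
pose a := Num.sqrt (1 - h).
pose b := Num.sqrt (1 + h).
pose t := Num.sqrt T.
pose L := Num.sqrt (ln T / T).
pose s := D / Num.sqrt V.
pose v := D ^+ 2 * T / 4.
have T0 : 0 < T by exact: lt_trans T1.
have v0 : 0 <= v by rewrite divr_ge0 // mulr_ge0 ?sqr_ge0 // ltW.
have V0 : 0 < V.
  by apply: lt_le_trans VT; rewrite divr_gt0 // mulr_gt0 // exprn_gt0.
have p2 : 2 <= p.
  rewrite -[2]ger0_norm // -sqrtr_sqr ler_wsqrtr // expr2 ler_wpM2l //.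
  exact: pi_ge2.
have p0 : 0 < p by exact: lt_le_trans p2.
have a0 : 2^-1 <= a.
  by rewrite -[2^-1]ger0_norm // -sqrtr_sqr ler_wsqrtr //; lra.
have ap : 0 < a by rewrite sqrtr_gt0.
have b1 : 1 <= b by rewrite -[X in X <= _]sqrtr1 ler_wsqrtr //; lra.
have bp : 0 < b by rewrite sqrtr_gt0.
have t0 : 0 < t by rewrite sqrtr_gt0.
have t2 : t ^+ 2 = T by rewrite sqr_sqrtr // ltW.
have s0 : 0 < s by rewrite divr_gt0 // sqrtr_gt0.
have L0 : 0 <= L by exact: sqrtr_ge0.
have hL : h <= 5 / 2 * L.
  have lT : 0 <= ln T / T by rewrite divr_ge0 ?ln_ge0 // ltW.
  rewrite -[5 / 2]ger0_norm // -(ger0_norm h0) -!sqrtr_sqr -sqrtrM ?sqr_ge0 //.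
  by rewrite ler_wsqrtr // hT; lra.
pose u := y ^+ 2 / (2 * V).
have u0 : 0 <= u by rewrite divr_ge0 ?sqr_ge0 // mulr_ge0 // ltW.
have boundE : bound = 12 * (C1 + 1) * (s * L + H / t + (T * t)^-1).
  rewrite /bound; congr (_ * _); rewrite mulrDl -invfM addrA; congr (_ + _ + _).
  have -> : ln T / (V * T) = V^-1 * (ln T / T) by rewrite invfM mulrCA.
  by rewrite sqrtrM ?invr_ge0 1?ltW // sqrtrV ?ltW // mulrA.
have qE : q = s / p * expR (- u).
  rewrite /q sqrtrM ?mulr_ge0 ?pi_ge0 // mulNr -/u -/p /s.
  by field; rewrite !gt_eqF // sqrtr_gt0.
have peak x : 0 < x -> Num.sqrt (2 / (pi * (x * T))) = 2 / (p * Num.sqrt x * t).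
  move=> x0; have -> : 2 / (pi * (x * T)) = 2 ^+ 2 / (2 * pi * x * T).
    by move: (pi : R) (pi_gt0 R) => c c0; field; rewrite !gt_eqF.
  rewrite sqrtrM ?sqr_ge0 // sqrtr_sqr ger0_norm // sqrtrV; last first.
    by rewrite !mulr_ge0 ?pi_ge0 // ltW.
  rewrite sqrtrM; last by rewrite !mulr_ge0 ?pi_ge0 // ltW.
  by rewrite sqrtrM // mulr_ge0 ?pi_ge0.
have s1E : s1 = D / 2 * (b * t) by rewrite /s1 sqrtrM // ltW.
have s2E : s2 = D / 2 * (a * t) by rewrite /s2 sqrtrM // ltW.
have V1E : V1 = V + h * v.
  by rewrite /V1 s1E !exprMn (sqr_sqrtr (ltW h1p)) t2 /v; field.
have V2E : V2 = V - h * v.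
  by rewrite /V2 s2E !exprMn (sqr_sqrtr (ltW h1m)) t2 /v; field.
have hv : h * v <= h * V by rewrite ler_wpM2l.
have hv0 : 0 <= h * v by exact: mulr_ge0.
have VV1 : V <= V1 by rewrite V1E lerDl.
have V1V : V1 <= (1 + h) * V by rewrite V1E mulrDl mul1r lerD2l.
have V2V : V2 <= V by rewrite V2E gerBl.
have VV2 : (1 - h) * V <= V2 by rewrite V2E mulrBl mul1r lerD2l lerN2.
have V1pos : 0 < V1 by exact: lt_le_trans VV1.
have V2pos : 0 < V2 by apply: lt_le_trans VV2; rewrite mulr_gt0.
pose M := (T * t)^-1.
have M0 : 0 <= M by rewrite invr_ge0 mulr_ge0 // ltW.
have errE : err = (6 * C1 + 2) * M by rewrite /err -/t /M; ring.
have sp0 : 0 <= s / p by rewrite divr_ge0 // ltW.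
have Ht0 : 0 <= H / t by rewrite divr_ge0 // ltW.
have E01 : 0 <= expR (- u) <= 1.
  by rewrite expR_ge0 -[X in _ <= X](@expR0 R) ler_expR oppr_le0.
have error_le : s / p * (6 * h) + 4 * (H / t) + err <= bound.
  have k0 : s / p * h <= s / 2 * (5 / 2 * L).
    by apply: ler_pM => //; rewrite ler_pM2l // lef_pV2 ?posrE.
  have k2 : 0 <= s * L by rewrite mulr_ge0 // ltW.
  have k3 : 0 <= C1 * (s * L) by exact: mulr_ge0.
  have k4 : 0 <= C1 * (H / t) by exact: mulr_ge0.
  have k5 : 0 <= C1 * M by exact: mulr_ge0.
  rewrite boundE errE -/M; lra.
have peak_le x : 1 <= p * x -> 2 / (p * x * t) * (2 * H) <= 4 * (H / t).
  move=> px; have -> : 4 * (H / t) = 2 / t * (2 * H) by ring.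
  rewrite ler_wpM2r ?mulr_ge0 // ler_pM2l // lef_pV2 ?posrE //.
    by rewrite ler_peMl // ltW.
  by rewrite mulr_gt0 // (lt_le_trans _ px).
have pa : 1 <= p * a by rewrite -(mulfV (_ : 2 != 0)) // ler_pM.
have pb : 1 <= p * b by rewrite -[1]mulr1 ler_pM // (le_trans _ p2) // ler1n.
split.
- have := @upper_combination _ (s / p)
    (2 / (p * a * t) * (s1 / Num.sqrt V1)) (expR (- u))
    (expR (- y ^+ 2 / (2 * V1))) h (2 / (p * a * t)) H (4 * (H / t)) sp0 h023 E01
    (expR_ge0 _).
  rewrite s1E => /(_ _ (peak_ratio_le D0 p0 ap bp t0 V0 VV1 (sqrt_ratio_le h023))
    (expR_larger_variance_le y V0 V1pos h0 V1V) (peak_le _ pa)) => key.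
  rewrite (peak _ h1m) -/a qE mulrDr mulrA.
  apply: le_trans (lerD (key _) (lexx err)) _; last by move: error_le; lra.
  by rewrite !mulr_ge0 ?invr_ge0 ?sqrtr_ge0 ?mulr_ge0 // ltW.
- have := @lower_combination _ (s / p)
    (2 / (p * b * t) * (s2 / Num.sqrt V2)) (expR (- u))
    (expR (- y ^+ 2 / (2 * V2))) h (2 / (p * b * t)) H (4 * (H / t)) sp0 h023 E01
    (expR_ge0 _).
  have h01 : 0 <= h < 1 by rewrite h0 -subr_gt0.
  rewrite s2E => /(_ (peak_ratio_ge D0 p0 ap bp t0 V2pos V2V (ltW h1m) (sqrt_ratio_ge h023))
    (expR_smaller_variance_ge y V0 V2pos h01 VV2) (peak_le _ pb)) => key.
  rewrite (peak _ h1p) -/b qE mulrBr mulrA.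
  apply: le_trans key _.
  by move: error_le; lra.
Qed.

(** * Countable sums and integrals *)

(** Countable additivity over an arbitrary countable index type, by transport
    along its coding in the natural numbers. *)
Lemma measure_bigcup_esum (d : measure_display) (T : measurableType d)
    (R : realType) (mu : {measure set T -> \bar R}) (K : countType)
    (E : K -> set T) (a : set K) :
  (forall k, measurable (E k)) -> trivIset [set: K] E ->
  mu (\bigcup_(k in a) E k) = \esum_(k in a) mu (E k).
Proof.
move=> mE tE.
pose F (i : nat) : set T :=
  if pickle_inv i is Some k then (if `[< a k >] then E k else set0) else set0.
have FE k : a k -> F (pickle k) = E k.
  by move=> ak; rewrite /F pickleK_inv; case: asboolP.
have F0 i : (pickle @` a) i \/ F i = set0.
  rewrite /F; case E1 : (pickle_inv i) => [k|]; last by right.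
  case: asboolP => ak; last by right.
  by left; exists k => //; have := @pickle_invK K i; rewrite E1 /= => ->.
have -> : \bigcup_(k in a) E k = \bigcup_i F i.
  apply/seteqP; split => w [].
    by move=> k ak Ew; exists (pickle k) => //; rewrite FE.
  move=> i _; have [[k ak <-]|->//] := F0 i.
  by rewrite FE // => Ew; exists k.
have mF i : measurable (F i).
  by have [[k ak <-]|->//] := F0 i; rewrite FE.
have tF : trivIset setT F.
  apply/trivIsetP => i j _ _ ij.
  have [[k ak ki]|->] := F0 i; last by rewrite set0I.
  have [[l al lj]|->] := F0 j; last by rewrite setI0.
  move: ij; rewrite -ki -lj !FE // => ij.
  move/trivIsetP: tE; apply => //.
  by apply: contra_neq ij => ->.
rewrite measure_bigcup //.
have -> : \esum_(k in a) mu (E k) = \esum_(k in a) mu (F (pickle k)).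
  by apply: eq_esum => k ak; rewrite FE.
rewrite -(esum_image _ _ (fun i => mu (F i))); last first.
  by move=> x y _ _; exact: (pcan_inj pickleK_inv).
rewrite nneseries_esum; last by [].
rewrite (_ : [set x | x \in [set: nat]] = setT); last first.
  by apply/seteqP; split=> x //= _; rewrite in_setT.
rewrite [RHS]esum_mkcond; apply: eq_esum => i _.
case: ifPn => // /negP iF.
by have [/mem_set//|->] := F0 i; rewrite measure0.
Qed.

Lemma esumZl (R : realType) (K : choiceType) (D : set K) (a : K -> \bar R)
    (c : R) : 0 < c -> (forall k, (0 <= a k)%E) ->
  (\esum_(k in D) (c%:E * a k) = c%:E * \esum_(k in D) a k)%E.
Proof.
have le (b : K -> \bar R) (e : R) : 0 < e -> (forall k, (0 <= b k)%E) ->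
    (\esum_(k in D) (e%:E * b k) <= e%:E * \esum_(k in D) b k)%E.
  move=> e0 b0; apply: ge_ereal_sup => _ [A [finA AD] <-].
  rewrite -ge0_mule_fsumr //; apply: lee_wpmul2l; first by rewrite lee_fin ltW.
  by apply: ereal_sup_ubound; exists A.
move=> c0 a0; apply/eqP; rewrite eq_le le //=.
have a0' k : (0 <= c%:E * a k)%E by rewrite mule_ge0 // lee_fin ltW.
have := le _ (c^-1) ltac:(by rewrite invr_gt0) a0'.
under eq_esum do rewrite muleA -EFinM mulVf ?gt_eqF // mul1e.
move=> h; have := @lee_wpmul2l _ c%:E ltac:(by rewrite lee_fin ltW) _ _ h.
by rewrite muleA -EFinM mulfV ?gt_eqF // mul1e.
Qed.

Lemma ae_measure_eq (d : measure_display) (T : measurableType d) (R : realType)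
    (mu : {measure set T -> \bar R}) (A B : set T) :
  measurable A -> measurable B -> {ae mu, forall w, A w <-> B w} -> mu A = mu B.
Proof.
move=> mA mB AB; rewrite -[A]setIT -[B]setIT -!integral_indic //.
apply: ae_eq_integral => //; try by apply/measurable_EFinP; exact: measurable_indic.
apply: filterS AB => w AB _; rewrite !indicE; congr (_%:R)%:E.
by have [wA|wA] := boolP (w \in A); have [wB|wB] := boolP (w \in B) => //;
  move: wA wB; rewrite ?inE ?notin_setE; tauto.
Qed.

(** Both sides are integrals against a finite sum of measures. *)
Lemma sum_ge0_integral_eq (d : measure_display) (T : measurableType d)
    (R : realType) (I : finType) (i0 : I) (mu nu : I -> {measure set T -> \bar R})
    (f : T -> \bar R) :
  (forall A, measurable A -> (\sum_i mu i A = \sum_i nu i A)%E) ->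
  measurable_fun [set: T] f -> (forall x, (0 <= f x)%E) ->
  (\sum_i \int[mu i]_x f x = \sum_i \int[nu i]_x f x)%E.
Proof.
move=> munu mf f0.
have sumE (g : I -> \bar R) :
    (\sum_i g i = \sum_(k < size (enum I)) g (nth i0 (enum I) k))%E.
  by rewrite -big_enum /= (big_nth i0) big_mkord.
rewrite !sumE.
rewrite -(@ge0_integral_measure_sum _ _ _ (fun k => mu (nth i0 (enum I) k))) //.
rewrite -(@ge0_integral_measure_sum _ _ _ (fun k => nu (nth i0 (enum I) k))) //.
apply: eq_measure_integral => A mA _ /=.
by have := munu A mA; rewrite !sumE.
Qed.

(** From $2Y-1=Y^2-(Y-1)^2$: the mean is determined by integrals of nonnegative
    functions, to which identities of second moments apply. *)
Lemma mean_of_squares (d : measure_display) (T : measurableType d)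
    (R : realType) (P : probability T R) (Y : T -> R) :
  measurable_fun [set: T] Y ->
  (forall c, (\int[P]_w ((Y w - c) ^+ 2)%:E < +oo)%E) ->
  mean P Y = 2^-1 * (fine (\int[P]_w ((Y w - 0) ^+ 2)%:E)%E
                     - fine (\int[P]_w ((Y w - 1) ^+ 2)%:E)%E + 1).
Proof.
move=> mY Yfin.
have iY c : P.-integrable [set: T] (EFin \o (fun w => (Y w - c) ^+ 2)).
  apply/integrableP; split.
    by apply/measurable_EFinP; apply: measurable_funX; exact: measurable_funB.
  under eq_integral do rewrite /= ger0_norm ?sqr_ge0 //.
  exact: Yfin.
have i1 : P.-integrable [set: T] (EFin \o (fun=> 1)).
  exact: (finite_measure_integrable_cst P 1).
rewrite /mean expectation.unlock.
rewrite -[LHS]/(\int[P]_w Y w)%R.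
transitivity (\int[P]_w (2^-1 * ((Y w - 0) ^+ 2 - (Y w - 1) ^+ 2 + 1))).
  by apply: eq_Rintegral => w _; field.
rewrite RintegralZl //; last first.
  apply: (@integrableD _ _ _ P setT measurableT
    (EFin \o (fun w => (Y w - 0) ^+ 2 - (Y w - 1) ^+ 2)) (EFin \o (fun=> 1))) => //.
  exact: (@integrableB _ _ _ P setT measurableT
    (EFin \o (fun w => (Y w - 0) ^+ 2)) (EFin \o (fun w => (Y w - 1) ^+ 2))).
rewrite RintegralD //; last first.
  exact: (@integrableB _ _ _ P setT measurableT
    (EFin \o (fun w => (Y w - 0) ^+ 2)) (EFin \o (fun w => (Y w - 1) ^+ 2))).
rewrite RintegralB //; congr (_ * (_ + _)).
by rewrite Rintegral_cst // mul1r; exact: (congr1 fine (probability_setT P)).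
Qed.

(** The two-sided squeeze of the point probability is integrated with a = 1 for
    one inequality and b = 1 for the other; A is the exceptional event. *)
Lemma ae_le_fine_integral (d : measure_display) (T : measurableType d)
    (R : realType) (P : probability T R) (f g : T -> R) (A : set T) (a b c : R) :
  measurable_fun [set: T] f -> measurable_fun [set: T] g -> measurable A ->
  (forall w, 0 <= f w <= 1) -> (forall w, 0 <= g w <= 1) ->
  0 <= a -> 0 <= b -> 0 <= c ->
  {ae P, forall w, a * f w <= b * g w + c + \1_A w} ->
  a * fine (\int[P]_w (f w)%:E)%E
  <= b * fine (\int[P]_w (g w)%:E)%E + c + fine (P A).
Proof.
move=> mf mg mA f01 g01 a0 b0 c0 fg.
have int_fin (u : T -> R) : measurable_fun [set: T] u -> (forall w, 0 <= u w <= 1) ->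
    (\int[P]_w (u w)%:E)%E = (fine (\int[P]_w (u w)%:E)%E)%:E.
  move=> mu u01; rewrite fineK // ge0_fin_numE.
    apply: le_lt_trans (_ : (\int[P]_w (1%:E) < +oo)%E).
      apply: ge0_le_integral => //.
      - by move=> w _; rewrite lee_fin; case/andP: (u01 w).
      - exact/measurable_EFinP.
      - by move=> w _; rewrite lee_fin; case/andP: (u01 w).
    rewrite integral_cst // mul1e.
    by apply: le_lt_trans (probability_le1 P measurableT) _; rewrite ltry.
  by apply: integral_ge0 => w _; rewrite lee_fin; case/andP: (u01 w).
have f0 w : 0 <= f w by case/andP: (f01 w).
have g0 w : 0 <= g w by case/andP: (g01 w).
have mind : measurable_fun [set: T] (\1_A : T -> R) by exact: measurable_indic.
rewrite -lee_fin !EFinD !EFinM -!int_fin // fineK ?fin_num_measure //.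
have -> : P A = (\int[P]_w (\1_A w)%:E)%E by rewrite integral_indic // setIT.
have -> : c%:E = (\int[P]_w c%:E)%E.
  by rewrite integral_cst // [X in (_ * X)%E]probability_setT mule1.
rewrite -!ge0_integralZl //; first last.
- by move=> w _; rewrite lee_fin.
- exact/measurable_EFinP.
- by move=> w _; rewrite lee_fin.
- exact/measurable_EFinP.
have mbg : measurable_fun [set: T] (fun w => (b%:E * (g w)%:E)%E).
  by apply/measurable_EFinP; exact: measurable_funM.
have mc : measurable_fun [set: T] (fun w : T => c%:E) by [].
rewrite -ge0_integralD //; last by move=> w _; rewrite -EFinM lee_fin mulr_ge0.
rewrite -ge0_integralD //; last 3 first.
- by move=> w _; rewrite -EFinM -EFinD lee_fin addr_ge0 // mulr_ge0.
- exact: emeasurable_funD.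
- exact/measurable_EFinP.
apply: ae_ge0_le_integral => //.
- by move=> w _; rewrite -EFinM lee_fin mulr_ge0.
- by apply/measurable_EFinP; exact: measurable_funM.
- by move=> w _; rewrite -EFinM -!EFinD lee_fin !addr_ge0 // mulr_ge0.
- apply: emeasurable_funD; first exact: emeasurable_funD.
  exact/measurable_EFinP.
by apply: filterS fg => w h _; rewrite -!EFinM -!EFinD lee_fin.
Qed.

(** * Averages over the outcomes of fair coins *)

Lemma average_const (R : realFieldType) n (x : \bar R) :
  ((2^-1 ^+ n)%:E * \sum_(l : {ffun 'I_n -> bool}) x = x)%E.
Proof.
have -> : (\sum_(l : {ffun 'I_n -> bool}) x
    = \sum_(l : {ffun 'I_n -> bool}) 1%:E * x)%E.
  by apply: eq_bigr => l _; rewrite mul1e.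
rewrite -ge0_sume_distrl // sumEFin sumr_const card_ffun card_bool card_ord.
by rewrite muleA -EFinM natrX -exprMn mulVf ?expr1n ?mul1e.
Qed.

Section sign_flip.
Context {R : realFieldType} {n : nat}.
Implicit Types l : {ffun 'I_n -> bool}.

Definition flip_bit (j : 'I_n) l : {ffun 'I_n -> bool} :=
  [ffun i => if i == j then ~~ l i else l i].

Lemma flip_bitK j : involutive (flip_bit j).
Proof.
by move=> l; apply/ffunP => i; rewrite !ffunE; case: eqP => // _; rewrite negbK.
Qed.

(** Flipping one coin permutes the outcomes. *)
Lemma sum_flip_odd (G : {ffun 'I_n -> bool} -> R) j :
  (forall l, G (flip_bit j l) = - G l) -> \sum_l G l = 0.
Proof.
move=> GN; have : \sum_l G l = - \sum_l G l.
  rewrite {1}(reindex_inj (inv_inj (flip_bitK j))) -sumrN.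
  by apply: eq_bigr => l _; exact: GN.
lra.
Qed.

(** The centred coins are uncorrelated with variance 1/4, so that only the
    diagonal terms survive the sum over all outcomes l. *)
Lemma sum_square_centred_coins (a : R) (x : 'I_n -> R) :
  \sum_(l : {ffun 'I_n -> bool}) (a + \sum_j x j * ((l j)%:R - 2^-1)) ^+ 2
  = \sum_(l : {ffun 'I_n -> bool}) (a ^+ 2 + \sum_j x j ^+ 2 / 4).
Proof.
pose s (l : {ffun 'I_n -> bool}) j : R := (l j)%:R - 2^-1.
have sN l j : s (flip_bit j l) j = - s l j.
  by rewrite /s ffunE eqxx; case: (l j) => /=; field.
have sE l i j : i != j -> s (flip_bit j l) i = s l i.
  by rewrite /s ffunE => /negbTE ->.
have s0 j : \sum_l s l j = 0 by exact: (sum_flip_odd (G := fun l => s l j)).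
have sij i j : \sum_l s l i * s l j = \sum_(l : {ffun 'I_n -> bool}) (if i == j then 4^-1 else 0).
  have [->|ij] := eqVneq i j.
    by apply: eq_bigr => l _; rewrite /s; case: (l j) => /=; field.
  rewrite big1_eq; apply: (sum_flip_odd (G := fun l => s l i * s l j) (j := j)).
  by move=> l; rewrite sN sE // mulrN.
have expand l : (a + \sum_j x j * s l j) ^+ 2
   = a ^+ 2 + (\sum_j (2 * a * x j) * s l j
       + \sum_i \sum_j (x i * x j) * (s l i * s l j)).
  rewrite sqrrD -addrA; congr (_ + (_ + _)).
    by rewrite mulr_sumr -sumrMnl; apply: eq_bigr => j _; rewrite -mulr_natl; ring.
  rewrite expr2 mulr_suml; apply: eq_bigr => i _.
  by rewrite mulr_sumr; apply: eq_bigr => j _; ring.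
under eq_bigr do rewrite expand.
rewrite !big_split /=; congr (_ + _).
rewrite exchange_big /= big1 ?add0r; last first.
  by move=> j _; rewrite -mulr_sumr s0 mulr0.
transitivity (\sum_i \sum_j (x i * x j) * \sum_l s l i * s l j).
  rewrite exchange_big /=; apply: eq_bigr => i _.
  by rewrite exchange_big /=; apply: eq_bigr => j _; rewrite mulr_sumr.
rewrite [RHS]exchange_big /=; apply: eq_bigr => i _.
rewrite (bigD1 i) //= [X in _ + X]big1 ?addr0; last first.
  by move=> j ji; rewrite sij eq_sym (negbTE ji) big1_eq mulr0.
by rewrite sij eqxx mulr_sumr; apply: eq_bigr => l _; rewrite expr2.
Qed.

End sign_flip.

Section coin_space.
Context {R : realType} (n : nat).
Local Notation outcomes := {ffun 'I_n -> bool}.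

Let half_pow : R := 2^-1 ^+ n.
Let half_pow_ge0 : 0 <= half_pow.
Proof. by rewrite exprn_ge0. Qed.

(** The uniform probability on the outcomes of n coins, carried by their codes
    in nat, where every set is measurable. *)
Definition coin_prob : set nat -> \bar R :=
  msum (fun k : nat => mscale (NngNum half_pow_ge0) (@dirac _ nat k R)) #|outcomes|.

HB.instance Definition _ := Measure.on coin_prob.

Definition outcome_of (k : nat) : outcomes := nth [ffun=> false] (enum outcomes) k.

Lemma coin_probE (A : set nat) :
  coin_prob A
  = (half_pow * \sum_(l : outcomes) (nat_of_ord (enum_rank l) \in A)%:R)%:E.
Proof.
rewrite /coin_prob /msum mulr_sumr -sumEFin.
rewrite (reindex (@enum_rank outcomes)) /=; last exact: onW_bij (enum_rank_bij _).
by apply: eq_bigr => l _; rewrite /mscale /= diracE -EFinM.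
Qed.

Let coin_probT : coin_prob setT = 1%E.
Proof.
rewrite coin_probE; congr EFin.
under eq_bigr do rewrite in_setT.
rewrite sumr_const card_ffun card_bool card_ord /half_pow natrX exprVn.
by rewrite mulVf // expf_neq0.
Qed.

HB.instance Definition _ := Measure_isProbability.Build _ _ _ coin_prob coin_probT.

Lemma coin_prob_outcome (p : pred outcomes) :
  coin_prob [set k | p (outcome_of k)] = (half_pow * \sum_(l : outcomes) (p l)%:R)%:E.
Proof.
rewrite coin_probE; congr (_ * _)%:E; apply: eq_bigr => l _.
congr (nat_of_bool _)%:R; apply/idP/idP => [/set_mem|pl]; last apply/mem_set;
  by rewrite /= /outcome_of nth_enum_rank.
Qed.

Variable A : {set 'I_n}.
Local Notation N := #|A|.

(** The coins indexed by a subset A of the n coins form a sequence of #|A|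
    independent fair coins on the space of all outcomes; the local limit theorem
    for #|A| coins is applied to them, so that averages over the n coins need not
    be reduced to fewer coins first. *)
Definition coin (i : 'I_N) (k : nat) : R := (outcome_of k (enum_val i))%:R.

Let measurable_coin i : measurable_fun [set: nat] (coin i).
Proof. by []. Qed.

HB.instance Definition _ i := isMeasurableFun.Build _ _ nat R (coin i) (measurable_coin i).

(** The indicator of the event is a product over all n coins of a function of
    that coin alone, equal to 1 for the coins not indexed by J. *)
Let coins_in (J : {set 'I_N}) (B : 'I_N -> set R) :
  coin_prob (\bigcap_(i in [set` J]) (coin i @^-1` B i))
  = (\prod_(i in J) (2^-1 * \sum_(c : bool) (c%:R \in B i)%:R))%:E.
Proof.
pose F (i : 'I_n) (c : bool) : R :=
  \prod_(j in J | enum_val j == i) (c%:R \in B j)%:R.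
transitivity (half_pow * \sum_(l : outcomes) \prod_i F i (l i))%:E.
  rewrite coin_probE; congr (_ * _)%:E; apply: eq_bigr => l _.
  transitivity (\prod_(j in J) ((l (enum_val j))%:R \in B j)%:R : R).
    have lE : coin ^~ (enum_rank l) =1 fun j => (l (enum_val j))%:R.
      by move=> j; rewrite /coin /outcome_of nth_enum_rank.
    case: (boolP (_ \in _)) => [/set_mem h|/negP h].
      rewrite big1 // => j jJ; rewrite mem_set // -lE; exact: h.
    have [j jJ hj] : exists2 j, j \in J & (l (enum_val j))%:R \notin B j.
      apply: contrapT => h'; apply: h; apply/mem_set => j /= jJ.
      rewrite /preimage /= lE; apply/set_mem; apply: contrapT => hj.
      by apply: h'; exists j => //; exact/negP.
    by rewrite (bigD1 j) //= (negbTE hj) mul0r.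
  rewrite (partition_big (@enum_val _ (mem A)) xpredT) //=; apply: eq_bigr => i _.
  by apply: eq_bigr => j /andP[_ /eqP <-].
congr EFin; rewrite -(bigA_distr_bigA F) /half_pow.
rewrite -[in X in X * _](card_ord n) -prodr_const -big_split /=.
rewrite [RHS](partition_big (@enum_val _ (mem A)) xpredT) //=.
apply: eq_bigr => i _; rewrite /F.
case: (pickP [pred j | (j \in J) && (enum_val j == i)]) => [j0 /andP[j0J /eqP ej0]|none].
  have P1 : (fun j => (j \in J) && (enum_val j == i)) =1 pred1 j0.
    move=> j /=; rewrite -ej0; apply/andP/eqP => [[_ /eqP /enum_val_inj]|->] //.
  rewrite (big_pred1 j0) //; congr (_ * _).
  by apply: eq_bigr => c _; rewrite (big_pred1 j0).
rewrite [RHS]big_pred0 //.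
under eq_bigr do rewrite big_pred0 //.
by rewrite big_bool /=; field.
Qed.

Let coin_in i (B : set R) :
  coin_prob (coin i @^-1` B) = (2^-1 * \sum_(c : bool) (c%:R \in B)%:R)%:E.
Proof.
have := coins_in [set i]%SET (fun=> B).
rewrite big_set1 => <-; congr coin_prob; apply/seteqP; split => k /=.
  by move=> Bk j; rewrite /= finset.inE => /eqP ->.
by apply; rewrite /= finset.inE.
Qed.

Lemma coin_independent : mutually_independent coin_prob coin.
Proof.
move=> J B _; apply: etrans (coins_in J B) _; rewrite -prodEFin.
by apply: eq_bigr => i _; exact/esym/coin_in.
Qed.

Lemma coin_fair i : coin_prob [set k | coin i k = 0] = (2^-1)%:E /\
             coin_prob [set k | coin i k = 1] = (2^-1)%:E.
Proof.
split; [rewrite (coin_in i [set 0])|rewrite (coin_in i [set 1])];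
  congr EFin; rewrite big_bool /=.
  by rewrite memNset ?mem_set //= ?add0r ?mulr1 // => /eqP; rewrite oner_eq0.
rewrite mem_set // memNset ?addr0 ?mulr1 //= => /eqP.
by rewrite eq_sym oner_eq0.
Qed.

Lemma fair_coin_bound (C0 : R) : coin_constant C0 -> (0 < N)%N -> forall z : int,
  `|2^-1 ^+ n * \sum_(l : outcomes) (\sum_(j in A) (l j)%:R == z%:~R :> R)%:R
    - Num.sqrt (2 / (pi * N%:R)) * expR (- (2 * z%:~R - N%:R) ^+ 2 / (2 * N%:R))|
  <= C0 * N%:R `^ (- (3 / 2)).
Proof.
move=> hC0 N0 z.
have := hC0 N N0 _ _ coin_prob (fun i => coin i) coin_independent coin_fair.
move=> h; pose F (y : int) :=
  (`|fine (coin_prob [set w | \sum_(j < N) coin j w = y%:~R])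
     - Num.sqrt (2 / (pi * N%:R)) * expR (- (2 * y%:~R - N%:R) ^+ 2 / (2 * N%:R))|)%:E.
have /le_trans/(_ h) := ereal_sup_ubound (imageT F z).
rewrite /F lee_fin.
have -> : [set w | \sum_(j < N) coin j w = z%:~R]
   = [set k | (fun l : outcomes => \sum_(j in A) (l j)%:R == z%:~R :> R) (outcome_of k)].
  have sumE k : \sum_(j in A) (outcome_of k j)%:R = \sum_(j < N) coin j k :> R.
    by rewrite big_enum_val.
  apply/seteqP; split => k /=; rewrite sumE.
    by move=> ->.
  by move=> /eqP.
by rewrite [X in fine X](coin_prob_outcome
  (fun l : outcomes => \sum_(j in A) (l j)%:R == z%:~R :> R)).
Qed.

End coin_space.

(** * The Bernoulli part of a lattice variable *)

Section bernoulli_part_law.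
Context {R : realType}.
Variables (v0 D : R) (d : measure_display) (T : measurableType d).
Variables (P : probability T R) (X : {RV P >-> R}).
Hypothesis D0 : 0 < D.
Hypothesis Xlat : P [set w | lattice v0 D (X w)] = 1%E.

Lemma lattice_point_inj : injective (lattice_point v0 D).
Proof.
move=> k l /addrI /(mulfI (lt0r_neq0 D0)) /eqP.
by rewrite eqr_int => /eqP.
Qed.

Lemma measurable_RV_eq d1 (T1 : measurableType d1) (Y : T1 -> R) x :
  measurable_fun [set: T1] Y -> measurable [set w | Y w = x].
Proof.
move=> mY; have := mY measurableT _ (measurable_set1 x).
by rewrite setTI; congr measurable; apply/seteqP.
Qed.

Lemma lattice_massE k :
  (lattice_mass v0 D P X k)%:E = P [set w | X w = lattice_point v0 D k].
Proof.
rewrite fineK // fin_num_measure //; exact: measurable_RV_eq.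
Qed.

Lemma lattice_mass_ge0 k : 0 <= lattice_mass v0 D P X k.
Proof. exact: fine_ge0. Qed.

Lemma esum_lattice_mass :
  (\esum_(k in [set: int]) (lattice_mass v0 D P X k)%:E = 1)%E.
Proof.
under eq_esum do rewrite lattice_massE.
rewrite -measure_bigcup_esum; first 1 last.
- by move=> k; exact: measurable_RV_eq.
- apply/trivIsetP => k l _ _ kl; apply/seteqP; split => // w /= [-> ].
  by move/lattice_point_inj => kl'; rewrite kl' eqxx in kl.
rewrite -Xlat; congr (P _); apply/seteqP; split => w /=.
  by move=> [k _ Xk]; exists k.
by move=> [k _ Xk]; exists k.
Qed.

Variable theta : R.
Hypothesis ov0 : 0 < overlap v0 D P X.
Hypothesis theta_ov : 0 < theta <= overlap v0 D P X.

Lemma tau_ge0 k : 0 <= tau v0 D P X theta k.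
Proof.
have /andP[t0 _] := theta_ov; rewrite mulr_ge0 //.
  by rewrite divr_ge0 // ltW.
by rewrite le_min !lattice_mass_ge0.
Qed.

Lemma esum_tau : (\esum_(k in [set: int]) (tau v0 D P X theta k)%:E = theta%:E)%E.
Proof.
have /andP[t0 _] := theta_ov.
under eq_esum do rewrite EFinM.
rewrite esumZl; last 2 first.
- by rewrite divr_gt0.
- by move=> k; rewrite lee_fin le_min !lattice_mass_ge0.
have ovE : (overlap v0 D P X)%:E = (\esum_(k in [set: int])
    (Num.min (lattice_mass v0 D P X k) (lattice_mass v0 D P X (k + 1)))%:E)%E.
  rewrite fineK // ge0_fin_numE; last first.
    by apply: esum_ge0 => k _; rewrite lee_fin le_min !lattice_mass_ge0.
  apply: le_lt_trans (ltry 1); rewrite -esum_lattice_mass.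
  by apply: le_esum => k _; rewrite lee_fin ge_min lexx.
by rewrite -ovE -EFinM divfK // gt_eqF.
Qed.

Context {d' : measure_display} {T' : measurableType d'} (Q : probability T' R).
Variables (V eps : {RV Q >-> R}).
Hypothesis law1 : forall k, Q [set w | V w = lattice_point v0 D k /\ eps w = 1]
  = (tau v0 D P X theta k)%:E.
Hypothesis law0 : forall k, Q [set w | V w = lattice_point v0 D k /\ eps w = 0]
  = (lattice_mass v0 D P X k
     - (tau v0 D P X theta (k - 1) + tau v0 D P X theta k) / 2)%:E.

Let E (e : R) k := [set w | V w = lattice_point v0 D k /\ eps w = e].

Lemma measurable_V_eps e k : measurable (E e k).
Proof. by apply: measurableI; exact: measurable_RV_eq. Qed.

Let tE e : trivIset [set: int] (E e).
Proof.
apply/trivIsetP => k l _ _ kl; apply/seteqP; split => // w /= [[Vk _] [+ _]].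
by rewrite Vk => /lattice_point_inj kl'; rewrite kl' eqxx in kl.
Qed.

(** The atoms with eps = 1 carry the total mass of tau, which is theta by the
    normalisation of tau; those with eps = 0 carry the remaining mass, since f is
    the sum of the law of (V, 0) and of two halves of tau. *)
Let Q1 : Q (\bigcup_k E 1 k) = theta%:E.
Proof.
rewrite measure_bigcup_esum //; last by move=> k; exact: measurable_V_eps.
by rewrite -esum_tau; apply: eq_esum => k _; exact: law1.
Qed.

Let Q0 : Q (\bigcup_k E 0 k) = (1 - theta)%:E.
Proof.
rewrite measure_bigcup_esum //; last by move=> k; exact: measurable_V_eps.
have tau2_ge0 k : (0 <= (tau v0 D P X theta k / 2)%:E)%E.
  by rewrite lee_fin divr_ge0 // tau_ge0.
have h2 : (\esum_(k in [set: int]) (tau v0 D P X theta (k - 1) / 2)%:E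
   = \esum_(k in [set: int]) (tau v0 D P X theta k / 2)%:E)%E.
  apply/esym; apply: (reindex_esum _ _ (fun k : int => k - 1)
     (fun k => (tau v0 D P X theta k / 2)%:E)) => //.
  split => //; first by move=> k l _ _ /= /addIr.
  by move=> k _ /=; exists (k + 1) => //; rewrite addrK.
have h : (\esum_(k in [set: int]) Q (E 0 k) + theta%:E = 1)%E.
  rewrite -esum_tau.
  have -> : (\esum_(k in [set: int]) (tau v0 D P X theta k)%:E =
     \esum_(k in [set: int]) ((tau v0 D P X theta (k - 1) / 2)%:E
         + (tau v0 D P X theta k / 2)%:E))%E.
    rewrite esumD // h2 -esumD //; apply: eq_esum => k _.
    by rewrite -EFinD; congr EFin; field.
  rewrite -esumD //; last by move=> k _; rewrite adde_ge0.
  rewrite -esum_lattice_mass; apply: eq_esum => k _.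
  by rewrite [X in (X + _)%E]law0 -!EFinD; congr EFin; field.
by rewrite EFinB -h addeK.
Qed.

Lemma bernoulli_part_ae :
  {ae Q, forall w, exists k, V w = lattice_point v0 D k /\ (eps w = 0 \/ eps w = 1)}.
Proof.
have mU e : measurable (\bigcup_k E e k).
  by apply: countable_bigcupT_measurable => // k; exact: measurable_V_eps.
have QU : Q (\bigcup_k E 0 k `|` \bigcup_k E 1 k) = 1%E.
  rewrite measureU //; first by rewrite [X in (X + _)%E]Q0 [X in (_ + X)%E]Q1 -EFinD subrK.
  apply/seteqP; split => // w /= [[k _ [_ e0]] [l _ [_ /eqP]]].
  by rewrite e0 eq_sym oner_eq0.
exists (~` (\bigcup_k E 0 k `|` \bigcup_k E 1 k)); split.
- by apply: measurableC; exact: measurableU.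
- by rewrite probability_setC ?QU ?subee //; exact: measurableU.
- apply: subsetC => w /= [[k _ [Vk e]]|[k _ [Vk e]]]; exists k; split => //;
  by [left|right].
Qed.

(** The masses at the lattice points already add up to 1, so that eps takes the
    values 0 and 1 with V on the lattice, up to a null event. *)
Lemma bernoulli_part_eps :
  Q [set w | eps w = 1] = theta%:E /\ Q [set w | eps w = 0] = (1 - theta)%:E.
Proof.
have mU e : measurable (\bigcup_k E e k).
  by apply: countable_bigcupT_measurable => // k; exact: measurable_V_eps.
have mE e : measurable [set w | eps w = e] by exact: measurable_RV_eq.
have ge e : (Q (\bigcup_k E e k) <= Q [set w | eps w = e])%E.
  by apply: le_measure; rewrite ?inE // => w [k _ []].
have le1 : (Q [set w | eps w = 0%R] + Q [set w | eps w = 1%R] <= 1)%E.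
  rewrite -measureU //; first by apply: probability_le1; exact: measurableU.
  apply/seteqP; split => // w /= [e0 /eqP].
  by rewrite e0 eq_sym oner_eq0.
move: (ge 0) (ge 1) le1; rewrite Q0 Q1.
rewrite -[Q [set w | eps w = 0]]fineK ?fin_num_measure //.
rewrite -[Q [set w | eps w = 1]]fineK ?fin_num_measure //.
rewrite -EFinD !lee_fin => g0 g1 l1.
by split; congr EFin; lra.
Qed.

(** The event is V + D b eps = lattice_point v0 D k, for a coin showing b. *)
Lemma bernoulli_part_split k (b : bool) :
  Q [set w | (V w = lattice_point v0 D k /\ eps w = 0)
          \/ (V w = lattice_point v0 D (k - b%:R) /\ eps w = 1)]
  = (lattice_mass v0 D P X k
     - (tau v0 D P X theta (k - 1) + tau v0 D P X theta k) / 2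
     + tau v0 D P X theta (k - b%:R))%:E.
Proof.
rewrite EFinD -law0 -law1 -measureU //; last 3 first.
- exact: (measurable_V_eps 0 k).
- exact: (measurable_V_eps 1 (k - b%:R)).
apply/seteqP; split => // w /= [[_ e0] [_ /eqP]].
by rewrite e0 eq_sym oner_eq0.
Qed.

(** Adding D times a fair coin b on the event eps = 1 turns the law of V back
    into that of X: half of the mass tau k stays at k and half moves to k + 1. *)
Lemma bernoulli_part_average k :
  \sum_(b : bool) lattice_mass v0 D P X k
  = \sum_(b : bool) (lattice_mass v0 D P X k
     - (tau v0 D P X theta (k - 1) + tau v0 D P X theta k) / 2
     + tau v0 D P X theta (k - b%:R)).
Proof. by rewrite !big_bool /= subr0; field. Qed.

End bernoulli_part_law.

(** * The local limit theorem *)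

Lemma mutually_independent_all (d d' : measure_display) (T : measurableType d)
    (T' : measurableType d') (R : realType) (P : probability T R) n
    (X : 'I_n -> T -> T') (A : 'I_n -> set T') :
  mutually_independent P X -> (forall j, measurable (A j)) ->
  P [set w | forall j, A j (X j w)] = (\prod_j P (X j @^-1` A j))%E.
Proof.
move=> indep mA.
have := indep [set: 'I_n]%SET A (fun j _ => mA j).
rewrite (eq_bigl xpredT); last by move=> j; rewrite finset.in_setT.
move=> <-; congr (P _); apply/seteqP; split => w /=.
  by move=> h j _; exact: h.
by move=> h j; apply: h; rewrite /= finset.in_setT.
Qed.

Section sum_law.
Context {R : realType}.
Variables (v0 D : R) (n : nat) (d : measure_display) (T : measurableType d).
Variables (P : probability T R) (X : 'I_n -> {RV P >-> R}).
Hypothesis D0 : 0 < D.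
Hypothesis Xindep : mutually_independent P (fun j => X j : T -> R).
Hypothesis Xlat : forall j, P [set w | lattice v0 D (X j w)] = 1%E.
Variable theta : 'I_n -> R.
Hypothesis ov0 : forall j, 0 < overlap v0 D P (X j).
Hypothesis theta_ov : forall j, 0 < theta j <= overlap v0 D P (X j).
Context {d' : measure_display} {T' : measurableType d'} (Q : probability T' R).
Variables (V eps : 'I_n -> {RV Q >-> R}).
Hypothesis bpart : is_bernoulli_part v0 D P (fun j => X j : T -> R) theta
             Q (fun j => V j : T' -> R) (fun j => eps j : T' -> R).

Let pt := lattice_point v0 D.

(** The value of S when the coins show l: X_j is realised as
    V_j + D eps_j l_j. *)
Definition coin_sum (l : {ffun 'I_n -> bool}) (w : T') : R :=
  \sum_j (V j w + D * (eps j w * (l j)%:R)).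

Lemma measurable_coin_sum l : measurable_fun [set: T'] (coin_sum l).
Proof.
apply: measurable_sum => j; apply: measurable_funD => //.
by apply: measurable_funM => //; exact: measurable_funM.
Qed.

Lemma family_ae :
  {ae Q, forall w, forall j, exists k, V j w = pt k /\ (eps j w = 0 \/ eps j w = 1)}.
Proof.
have [_ l1 l0] := bpart.
have h j := bernoulli_part_ae D0 (Xlat j) (ov0 j) (theta_ov j) (l1 j) (l0 j).
by apply: filter_forall => j; exact: h.
Qed.

Lemma lattice_ae : {ae P, forall w, forall j, exists k, X j w = pt k}.
Proof.
apply: filter_forall => j.
have mL : measurable [set w | lattice v0 D (X j w)].
  have -> : [set w | lattice v0 D (X j w)]
      = \bigcup_(k in [set: int]) [set w | X j w = pt k].
    by apply/seteqP; split => w /= [k _ Xk]; exists k.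
  by apply: countable_bigcupT_measurable => // k; exact: measurable_RV_eq.
exists (~` [set w | lattice v0 D (X j w)]); split.
- exact: measurableC.
- by rewrite probability_setC // Xlat subee.
- by apply: subsetC => w [k _ Xk]; exists k.
Qed.

(** F l k is the event that the summands V_j + D eps_j l_j sit at the lattice
    points with indices k_j, as E k is for the X_j. *)
Let E (k : {ffun 'I_n -> int}) := [set w | forall j, X j w = pt (k j)].
Let F (l : {ffun 'I_n -> bool}) (k : {ffun 'I_n -> int}) :=
  [set w | forall j, (V j w = pt (k j) /\ eps j w = 0)
          \/ (V j w = pt (k j - (l j)%:R) /\ eps j w = 1)].

Let measurable_forall d1 (T1 : measurableType d1) (A : 'I_n -> set T1) :
  (forall j, measurable (A j)) -> measurable [set w | forall j, A j w].
Proof.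
move=> mA; rewrite (_ : [set w | _] = \bigcap_(j in [set: 'I_n]) A j).
  exact: fin_bigcap_measurable.
by apply/seteqP; split => w /= h j => [_|]; exact: h.
Qed.

Let mE k : measurable (E k).
Proof.
apply: (measurable_forall (A := fun j => [set w | X j w = pt (k j)])) => j.
exact: measurable_RV_eq.
Qed.

Let mF l k : measurable (F l k).
Proof.
apply: (measurable_forall (A := fun j => [set w |
  (V j w = pt (k j) /\ eps j w = 0)
          \/ (V j w = pt (k j - (l j)%:R) /\ eps j w = 1)])) => j.
by apply: measurableU; exact: measurable_V_eps.
Qed.

Let tE : trivIset setT E.
Proof.
apply/trivIsetP => k k' _ _ kk'; apply/seteqP; split => // w /= [Ek Ek'].
move/eqP: kk'; apply; apply/ffunP => j.
by have := Ek j; rewrite (Ek' j) => /(lattice_point_inj D0) ->.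
Qed.

Let tF l : trivIset setT (F l).
Proof.
apply/trivIsetP => k k' _ _ kk'; apply/seteqP; split => // w /= [Fk Fk'].
move/eqP: kk'; apply; apply/ffunP => j.
have [[Vk e]|[Vk e]] := Fk j; have [[Vk' e']|[Vk' e']] := Fk' j.
- by move: Vk; rewrite Vk' => /(lattice_point_inj D0) ->.
- by move/eqP: e; rewrite e' oner_eq0.
- by move/eqP: e'; rewrite e oner_eq0.
- by move: Vk; rewrite Vk' => /(lattice_point_inj D0) /addIr ->.
Qed.

Let sum_E k w : E k w -> \sum_j X j w = \sum_j pt (k j).
Proof. by move=> Ekw; apply: eq_bigr => j _; exact: Ekw. Qed.

Let sum_F l k w : F l k w -> coin_sum l w = \sum_j pt (k j).
Proof.
move=> Fkw; apply: eq_bigr => j _.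
have [[-> ->]|[-> ->]] := Fkw j; first by rewrite mul0r mulr0 addr0.
by rewrite /pt /lattice_point rmorphB /= mul1r; case: (l j) => /=; ring.
Qed.

Let atoms k : (\sum_(l : {ffun 'I_n -> bool}) P (E k) = \sum_l Q (F l k))%E.
Proof.
have [Vindep l1 l0] := bpart.
pose f j := lattice_mass v0 D P (X j) (k j).
pose g j (b : bool) := lattice_mass v0 D P (X j) (k j)
     - (tau v0 D P (X j) (theta j) (k j - 1) + tau v0 D P (X j) (theta j) (k j)) / 2
     + tau v0 D P (X j) (theta j) (k j - b%:R).
have PE : P (E k) = (\prod_j f j)%:E.
  rewrite (mutually_independent_all (A := fun j => [set pt (k j)]) Xindep) //.
  by rewrite -prodEFin; apply: eq_bigr => j _; rewrite lattice_massE.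
have QE (l : {ffun 'I_n -> bool}) : Q (F l k) = (\prod_j g j (l j))%:E.
  pose A j : set (R * R) := ([set pt (k j)] `*` [set 0])
    `|` ([set pt (k j - (l j)%:R)] `*` [set 1]).
  have -> : F l k = [set w | forall j, A j (V j w, eps j w)] by [].
  rewrite (mutually_independent_all (A := A) Vindep); last first.
    by move=> j; apply: measurableU; apply: measurableX.
  rewrite -prodEFin; apply: eq_bigr => j _.
  exact: (bernoulli_part_split (l1 j) (l0 j)).
under eq_bigr do rewrite PE; under [RHS]eq_bigr do rewrite QE.
rewrite !sumEFin; congr EFin.
rewrite -(bigA_distr_bigA (fun j b => g j b)) /=.
rewrite -(bigA_distr_bigA (fun j (b : bool) => f j)) /=.
by apply: eq_bigr => j _; exact: bernoulli_part_average.
Qed.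

(** Both sides are sums over the countably many possible values k of the
    summands, so it suffices to compare the probabilities of the atoms; by
    independence these factor over j, and the sum over l of a product is a
    product of sums. *)
Lemma sum_law (A : set R) : measurable A ->
  (\sum_(l : {ffun 'I_n -> bool}) P [set w | A (\sum_j X j w)%R]
   = \sum_l Q [set w | A (coin_sum l w)])%E.
Proof.
move=> mA.
pose a : set {ffun 'I_n -> int} := [set k | A (\sum_j pt (k j))].
have PA : P [set w | A (\sum_j X j w)%R] = (\esum_(k in a) P (E k))%E.
  rewrite -measure_bigcup_esum //; apply: ae_measure_eq.
  - have mS : measurable_fun [set: T] (fun w => \sum_j X j w).
      exact: measurable_sum.
    by have := mS measurableT _ mA; rewrite setTI.
  - by rewrite bigcup_mkcond; apply: countable_bigcupT_measurable => // k; case: ifP.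
  - apply: filterS lattice_ae => w /choice[k kw].
    have Ekw : E [ffun j => k j] w by move=> j; rewrite ffunE.
    split => [Aw|[k' ak' /sum_E Sk]] /=; last by rewrite Sk.
    by exists [ffun j => k j] => //; rewrite /a /= -(sum_E Ekw).
have QA l : Q [set w | A (coin_sum l w)] = (\esum_(k in a) Q (F l k))%E.
  rewrite -measure_bigcup_esum //; apply: ae_measure_eq.
  - by have := measurable_coin_sum l measurableT mA; rewrite setTI.
  - by rewrite bigcup_mkcond; apply: countable_bigcupT_measurable => // k; case: ifP.
  - apply: filterS family_ae => w /choice[k kw].
    have Fkw : F l [ffun j => if eps j w == 1 then k j + (l j)%:R else k j] w.
      move=> j; rewrite ffunE; have [-> [->|->]] := kw j.
        by left; rewrite eq_sym oner_eq0.
      by right; rewrite eqxx addrK.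
    split => [Aw|[k' ak' /sum_F Sk]] /=; last by rewrite Sk.
    by exists [ffun j => if eps j w == 1 then k j + (l j)%:R else k j] => //;
      rewrite /a /= -(sum_F Fkw).
under eq_bigr do rewrite PA; under [RHS]eq_bigr do rewrite QA.
rewrite -!esum_sum //; apply: eq_esum => k _; exact: atoms.
Qed.

Let S w := \sum_j X j w.
Let S' w := \sum_j V j w + D / 2 * \sum_j eps j w.
Let Theta := \sum_j theta j.

Let mS : measurable_fun [set: T] S.
Proof. exact: measurable_sum. Qed.

Let mS' : measurable_fun [set: T'] S'.
Proof.
by apply: measurable_funD; [|apply: measurable_funM => //]; exact: measurable_sum.
Qed.

Lemma sum_law_integral (f : R -> \bar R) :
  measurable_fun [set: R] f -> (forall x, (0 <= f x)%E) ->
  (\sum_(l : {ffun 'I_n -> bool}) \int[P]_w f (S w)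
   = \sum_l \int[Q]_w f (coin_sum l w))%E.
Proof.
move=> mf f0.
pose SM : {mfun T >-> R} := HB.pack S (isMeasurableFun.Build _ _ T R S mS).
pose CM l : {mfun T' >-> R} :=
  HB.pack (coin_sum l) (isMeasurableFun.Build _ _ T' R _ (measurable_coin_sum l)).
transitivity (\sum_(l : {ffun 'I_n -> bool}) \int[distribution P SM]_x f x)%E.
  by apply: eq_bigr => l _; rewrite ge0_integral_distribution.
rewrite (@sum_ge0_integral_eq _ R R {ffun 'I_n -> bool} [ffun=> false]
  (fun=> distribution P SM) (fun l => distribution Q (CM l)) f) //; last exact: sum_law.
by apply: eq_bigr => l _; rewrite ge0_integral_distribution.
Qed.

Lemma integral_eps j : (\int[Q]_w (\1_[set w | eps j w = 1] w)%:E = (theta j)%:E)%E.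
Proof.
have [_ l1 l0] := bpart.
rewrite integral_indic //; last exact: measurable_RV_eq.
by rewrite setIT; exact: (bernoulli_part_eps D0 (Xlat j) (ov0 j) (theta_ov j) (l1 j) (l0 j)).1.
Qed.

(** Given (V, eps), the sum S - c is S' - c plus D times a combination of centred
    coins, whose conditional variance is $D^2B/4$. *)
Lemma second_moment c :
  (\int[P]_w ((S w - c) ^+ 2)%:E
   = \int[Q]_w ((S' w - c) ^+ 2)%:E + (D ^+ 2 * Theta / 4)%:E)%E.
Proof.
have mcoin := measurable_coin_sum.
have msq d1 (T1 : measurableType d1) (f : T1 -> R) : measurable_fun setT f ->
    measurable_fun setT (fun w => ((f w - c) ^+ 2)%:E).
  by move=> mf; apply/measurable_EFinP; apply: measurable_funX; exact: measurable_funB.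
have mind j : measurable_fun [set: T'] (fun w => (\1_[set w | eps j w = 1] w : R)).
  by apply: measurable_indic; exact: measurable_RV_eq.
have mB : measurable_fun [set: T']
    (fun w => D ^+ 2 / 4 * \sum_j (\1_[set w | eps j w = 1] w : R)).
  by apply: measurable_funM => //; exact: measurable_sum.
have B0 w : 0 <= D ^+ 2 / 4 * \sum_j (\1_[set w | eps j w = 1] w : R).
  by apply: mulr_ge0; [rewrite divr_ge0 ?sqr_ge0|apply: sumr_ge0 => j _; rewrite indicE].
have key : (\sum_(l : {ffun 'I_n -> bool}) \int[P]_w ((S w - c) ^+ 2)%:E
  = \sum_(l : {ffun 'I_n -> bool})
      (\int[Q]_w ((S' w - c) ^+ 2)%:E + (D ^+ 2 * Theta / 4)%:E))%E.
  rewrite (@sum_law_integral (fun x => ((x - c) ^+ 2)%:E)); last 2 first.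
  - exact: msq.
  - by move=> x; rewrite lee_fin sqr_ge0.
  rewrite -ge0_integral_sum //; last 2 first.
  - by move=> l; exact: msq.
  - by move=> l w _; rewrite lee_fin sqr_ge0.
  transitivity (\int[Q]_w (\sum_(l : {ffun 'I_n -> bool})
     (((S' w - c) ^+ 2)%:E
       + (D ^+ 2 / 4 * \sum_j \1_[set w | eps j w = 1%R] w)%:E)))%E.
    apply: ae_eq_integral => //.
    - by apply: emeasurable_sum => l; exact: msq.
    - apply: emeasurable_sum => l; apply: emeasurable_funD; first exact: msq.
      exact/measurable_EFinP.
    apply: filterS family_ae => w kw _.
    under [RHS]eq_bigr do rewrite -EFinD.
    rewrite !sumEFin; congr EFin.
    have := @sum_square_centred_coins R n (S' w - c) (fun j => D * eps j w).
    have -> : \sum_(l : {ffun 'I_n -> bool})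
       (S' w - c + \sum_j D * eps j w * ((l j)%:R - 2^-1)) ^+ 2
       = \sum_(l : {ffun 'I_n -> bool}) (coin_sum l w - c) ^+ 2.
      apply: eq_bigr => l _; congr (_ ^+ 2).
      rewrite /coin_sum /S' addrAC; congr (_ - _).
      rewrite mulr_sumr -addrA -big_split /= -big_split /=.
      by apply: eq_bigr => j _; field.
    move=> ->; apply: eq_bigr => l _; congr (_ + _).
    rewrite mulr_sumr; apply: eq_bigr => j _.
    have [k [_ [e|e]]] := kw j; rewrite e indicE.
      rewrite memNset ?mulr0 ?expr0n ?mul0r //= e => /eqP.
      by rewrite eq_sym oner_eq0.
    by rewrite mem_set //= !mulr1.
  rewrite ge0_integral_sum //; last 2 first.
  - move=> l; apply: emeasurable_funD; first exact: msq.
    exact/measurable_EFinP.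
  - by move=> l w _; rewrite -EFinD lee_fin addr_ge0 // sqr_ge0.
  apply: eq_bigr => l _; rewrite ge0_integralD //; last 4 first.
  - by move=> w _; rewrite lee_fin sqr_ge0.
  - exact: msq.
  - by move=> w _; rewrite lee_fin.
  - exact/measurable_EFinP.
  congr (_ + _).
  under eq_integral do rewrite EFinM.
  rewrite ge0_integralZl //; last 3 first.
  - by apply/measurable_EFinP; exact: measurable_sum.
  - by move=> w _; rewrite lee_fin; apply: sumr_ge0 => j _; rewrite indicE.
  - by rewrite lee_fin divr_ge0 ?sqr_ge0.
  under eq_integral do rewrite -sumEFin.
  rewrite ge0_integral_sum //; last by move=> j; exact/measurable_EFinP.
  under eq_bigr do rewrite integral_eps.
  by rewrite sumEFin -EFinM; congr EFin; rewrite /Theta; field.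
by rewrite -[LHS](average_const n) key average_const.
Qed.

Hypothesis X2 : forall j, (X j : T -> R) \in Lfun P 2%:E.

Let S2 c : (\int[P]_w ((S w - c) ^+ 2)%:E < +oo)%E.
Proof.
have SL : S \in Lfun P 2%:E.
  have -> : S = \sum_j (X j : T -> R) by apply/funext => w; rewrite /S fct_sumE.
  by apply: rpred_sum => //= *; rewrite ?lee1n.
have SB : (fun w => S w - c) \in Lfun P 2%:E.
  have -> : (fun w => S w - c) = S - cst c by [].
  by rewrite rpredB ?Lfun_cst ?lee1n //= => _; exact: Lfun_cst.
have /integrableP[_] := Lfun2_integrable_sqr SB.
by under eq_integral do rewrite /= ger0_norm ?sqr_ge0 //.
Qed.

Lemma symmetrized_square_lty c : (\int[Q]_w ((S' w - c) ^+ 2)%:E < +oo)%E.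
Proof.
apply: le_lt_trans (S2 c); rewrite second_moment leeDl // lee_fin.
rewrite divr_ge0 // mulr_ge0 ?sqr_ge0 // sumr_ge0 // => j _.
by have /andP[/ltW] := theta_ov j.
Qed.

Let sq_fin c : (\int[Q]_w ((S' w - c) ^+ 2)%:E)%E \is a fin_num.
Proof.
rewrite ge0_fin_numE ?symmetrized_square_lty //.
by apply: integral_ge0 => w _; rewrite lee_fin sqr_ge0.
Qed.

Lemma symmetrized_mean : mean P S = mean Q S'.
Proof.
rewrite (mean_of_squares mS S2) (mean_of_squares mS' symmetrized_square_lty).
rewrite (second_moment 0) (second_moment 1) (fineD (sq_fin 0)) // (fineD (sq_fin 1)) //.
by congr (_ * (_ + _)); rewrite opprD addrACA subrr addr0.
Qed.

Lemma symmetrized_var : var P S = var Q S' + D ^+ 2 * Theta / 4.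
Proof. by rewrite !varE symmetrized_mean second_moment (fineD (sq_fin _)). Qed.

Let B w := \sum_j eps j w.

Let theta01 j : 0 <= theta j <= 1.
Proof.
have [_ l1 l0] := bpart.
have [_ e0] := bernoulli_part_eps D0 (Xlat j) (ov0 j) (theta_ov j) (l1 j) (l0 j).
have /andP[t0 _] := theta_ov j; rewrite ltW //=.
have : (0 <= Q [set w | eps j w = 0%R])%E by [].
by rewrite e0 lee_fin subr_ge0.
Qed.

Let mB : measurable_fun [set: T'] B.
Proof. exact: measurable_sum. Qed.

Definition deviation_event (h : R) := [set w | h * Theta < `|B w - Theta|].

Lemma measurable_deviation_event h : measurable (deviation_event h).
Proof.
rewrite (_ : deviation_event h = (fun w => `|B w - Theta|) @^-1` `]h * Theta, +oo[).
  rewrite -[X in measurable X]setTI.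
  have mBT : measurable_fun [set: T'] (fun w => `|B w - Theta|).
    by apply: measurableT_comp => //; exact: measurable_funB.
  by apply: mBT.
by apply/seteqP; split => w /=; rewrite in_itv /= andbT.
Qed.

(** The law of eps is that of independent Bernoulli variables with parameters
    theta. *)
Lemma deviation_probability (h : R) : 0 <= h <= 2 / 3 ->
  fine (Q (deviation_event h)) <= 2 * expR (- (Theta * h ^+ 2 / 4)).
Proof.
move=> h01; apply: le_trans (bernoulli_tail theta01 h01).
have [Vindep l1 l0] := bpart.
pose G (e : {ffun 'I_n -> bool}) := [set w | forall j, eps j w = (e j)%:R].
have mepsj j (b : bool) : measurable [set w | eps j w = b%:R].
  exact: measurable_RV_eq.
have mG e : measurable (G e).
  rewrite (_ : G e = \bigcap_(j in [set: 'I_n]) [set w | eps j w = (e j)%:R]).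
    exact: fin_bigcap_measurable.
  by apply/seteqP; split => w /= Gw j => [_|]; exact: Gw.
have QG e : Q (G e) = (bernoulli_weight theta e)%:E.
  pose A j : set (R * R) := [set: R] `*` [set (e j)%:R].
  have -> : G e = [set w | forall j, A j (V j w, eps j w)].
    by apply/seteqP; split => w /= Gw j; [split => //; exact: Gw|have [] := Gw j].
  rewrite (mutually_independent_all (A := A) Vindep); last first.
    by move=> j; exact: measurableX.
  rewrite /bernoulli_weight -prodEFin; apply: eq_bigr => j _.
  rewrite (_ : _ @^-1` _ = [set w | eps j w = (e j)%:R]); last first.
    by apply/seteqP; split => w /=; [case|split].
  have [e1 e0] := bernoulli_part_eps D0 (Xlat j) (ov0 j) (theta_ov j) (l1 j) (l0 j).
  by case: (e j); [exact: e1|exact: e0].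
rewrite -lee_fin fineK ?fin_num_measure //; last exact: measurable_deviation_event.
rewrite -sumEFin.
have -> : Q (deviation_event h) = (\int[Q]_w (\1_(deviation_event h) w)%:E)%E.
  by rewrite integral_indic ?setIT //; exact: measurable_deviation_event.
have mind e : measurable_fun [set: T'] (fun w => (\1_(G e) w : R)%:E).
  by apply/measurable_EFinP; exact: measurable_indic.
apply: (@le_trans _ _ (\int[Q]_w (\sum_(e : {ffun 'I_n -> bool} |
   (h * Theta < `|\sum_j (e j)%:R - Theta|)%R) (\1_(G e) w)%:E))%E); last first.
  under eq_integral do rewrite -big_filter.
  rewrite ge0_integral_sum //.
  by rewrite big_filter; apply: lee_sum => e _; rewrite integral_indic // setIT [X in (X <= _)%E]QG.
apply: ae_ge0_le_integral => //.
- apply/measurable_EFinP; apply: measurable_indic; exact: measurable_deviation_event.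
- by move=> w _; apply: sume_ge0 => e _; rewrite lee_fin indicE.
- by under eq_fun do rewrite -big_filter; exact: emeasurable_sum.
apply: filterS family_ae => w kw _.
rewrite indicE; have [/set_mem dw|_] := boolP (_ \in _); last first.
  by apply: sume_ge0 => e _; rewrite lee_fin indicE.
pose e : {ffun 'I_n -> bool} := [ffun j => eps j w == 1].
have epsE j : eps j w = (e j)%:R.
  rewrite ffunE; have [k [_ [->|->]]] := kw j; last by rewrite eqxx.
  by rewrite eq_sym oner_eq0.
have BE : B w = \sum_j (e j)%:R by apply: eq_bigr => j _.
rewrite (bigD1 e) /=; last by rewrite -BE.
rewrite [X in (X + _)%E](_ : _ = 1%E); last by rewrite indicE mem_set.
by rewrite leeDl //; apply: sume_ge0 => e' _; rewrite lee_fin indicE.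
Qed.

(** The conditional probability that the realised S equals kappa, given (V, eps). *)
Definition hitting_weight (kappa : R) (w : T') : R :=
  2^-1 ^+ n * \sum_(l : {ffun 'I_n -> bool}) (coin_sum l w == kappa)%:R.

Let mhit (kappa : R) l : measurable [set w | coin_sum l w = kappa].
Proof. by apply: measurable_RV_eq; exact: measurable_coin_sum. Qed.

Let hitE kappa : hitting_weight kappa = fun w =>
  2^-1 ^+ n * \sum_(l : {ffun 'I_n -> bool}) \1_[set w | coin_sum l w = kappa] w.
Proof.
apply/funext => w; congr (_ * _); apply: eq_bigr => l _; rewrite indicE.
congr (nat_of_bool _)%:R; apply/eqP/idP => [h|/set_mem //]; exact/mem_set.
Qed.

Lemma measurable_hitting_weight kappa : measurable_fun [set: T'] (hitting_weight kappa).
Proof.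
rewrite hitE; apply: measurable_funM => //; apply: measurable_sum => l.
exact: measurable_indic.
Qed.

Lemma hitting_weight01 kappa w : 0 <= hitting_weight kappa w <= 1.
Proof.
have c : 2^-1 ^+ n * \sum_(l : {ffun 'I_n -> bool}) 1 = 1 :> R.
  by rewrite sumr_const card_ffun card_bool card_ord natrX -exprMn mulVf ?expr1n.
apply/andP; split; first by rewrite mulr_ge0 ?exprn_ge0 // sumr_ge0.
rewrite -[X in _ <= X]c ler_wpM2l ?exprn_ge0 //; apply: ler_sum => l _.
by rewrite lern1 leq_b1.
Qed.

Lemma point_probability (kappa : R) :
  P [set w | S w = kappa] = (\int[Q]_w (hitting_weight kappa w)%:E)%E.
Proof.
rewrite -[LHS](average_const n) (sum_law (measurable_set1 kappa)) hitE.
have m1 l : measurable_fun [set: T'] (fun w => (\1_[set w | coin_sum l w = kappa] w : R)%:E).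
  by apply/measurable_EFinP; exact: measurable_indic.
under [RHS]eq_integral do rewrite EFinM -sumEFin.
rewrite ge0_integralZl //; last 2 first.
- exact: emeasurable_sum.
- by move=> w _; apply: sume_ge0 => l _; rewrite lee_fin indicE.
congr (_ * _)%E; rewrite ge0_integral_sum //; apply: eq_bigr => l _.
by rewrite integral_indic // setIT.
Qed.

(** Given (V, eps), the sum hits kappa when the B coins with eps_j = 1 show z heads,
    where z = (kappa - W) / D; and 2 z - B = 2 (kappa - S') / D. *)
Lemma hitting_weight_near (C0 : R) (K : int) : coin_constant C0 ->
  {ae Q, forall w, 0 < B w ->
    `|hitting_weight (lattice_point (v0 * n%:R) D K) w
      - Num.sqrt (2 / (pi * B w))
        * expR (- (2 * (lattice_point (v0 * n%:R) D K - S' w) / D) ^+ 2 / (2 * B w))|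
    <= C0 * B w `^ (- (3 / 2))}.
Proof.
move=> hC0; set kappa := lattice_point _ _ _.
apply: filterS family_ae => w /choice[k kw] B0.
pose A := [set j | eps j w == 1]%SET.
have epsE j : eps j w = (j \in A)%:R.
  rewrite finset.inE; have [_ [->|->]] := kw j; last by rewrite eqxx.
  by rewrite eq_sym oner_eq0.
have BE : B w = #|A|%:R.
  rewrite /B -sum1_card natr_sum [RHS]big_mkcond; apply: eq_bigr => j _.
  by rewrite epsE; case: (j \in A).
have N0 : (0 < #|A|)%N by rewrite BE ltr0n in B0.
pose z : int := K - \sum_j k j.
have WE : \sum_j V j w = v0 * n%:R + D * (\sum_j k j)%:~R.
  have -> : v0 * n%:R = \sum_(j < n) v0 by rewrite sumr_const card_ord mulr_natr.
  rewrite rmorph_sum /= mulr_sumr -big_split /=.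
  by apply: eq_bigr => j _; have [-> _] := kw j.
have zE : kappa - \sum_j V j w = D * z%:~R.
  by rewrite WE /kappa /lattice_point /z rmorphB /=; ring.
have sumE (l : {ffun 'I_n -> bool}) :
    (coin_sum l w == kappa) = (\sum_(j in A) (l j)%:R == z%:~R :> R).
  have -> : coin_sum l w = \sum_j V j w + D * \sum_(j in A) (l j)%:R.
    rewrite /coin_sum big_split /= -mulr_sumr; congr (_ + D * _).
    rewrite [RHS]big_mkcond; apply: eq_bigr => j _.
    by rewrite epsE; case: (j \in A); rewrite ?mul1r ?mul0r.
  have -> : kappa = \sum_j V j w + D * z%:~R by rewrite -zE addrC subrK.
  by rewrite (inj_eq (addrI _)) (inj_eq (mulfI (lt0r_neq0 D0))).
have argE : 2 * (kappa - S' w) / D = 2 * z%:~R - #|A|%:R.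
  rewrite /S' -/(B w) BE opprD addrA zE.
  by field; exact: lt0r_neq0.
have := fair_coin_bound hC0 N0 z.
rewrite argE BE /hitting_weight.
by under [in X in _ -> X]eq_bigr do rewrite sumE.
Qed.

Let kernel (sd kappa : R) w : R := expR (- (kappa - S' w) ^+ 2 / (2 * sd ^+ 2)).

Let measurable_kernel sd kappa : measurable_fun [set: T'] (kernel sd kappa).
Proof.
apply: measurableT_comp => //; apply: measurable_funM => //.
by apply: measurableT_comp => //; apply: measurable_funX; exact: measurable_funB.
Qed.

Let kernel01 sd kappa w : 0 <= kernel sd kappa w <= 1.
Proof.
rewrite expR_ge0 /= -[X in _ <= X](@expR0 R) ler_expR mulNr oppr_le0.
by rewrite divr_ge0 ?sqr_ge0 // mulr_ge0 ?sqr_ge0.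
Qed.

Let kernelE (c kappa : R) w : 0 < c ->
  kernel (D / 2 * Num.sqrt c) kappa w
  = expR (- (2 * (kappa - S' w) / D) ^+ 2 / (2 * c)).
Proof.
move=> c0; rewrite /kernel exprMn sqr_sqrtr ?ltW //; congr expR.
by field; rewrite !gt_eqF.
Qed.

Let kernel_le (c c' kappa : R) w : 0 < c -> c <= c' ->
  kernel (D / 2 * Num.sqrt c) kappa w <= kernel (D / 2 * Num.sqrt c') kappa w.
Proof.
move=> c0 cc'; have c'0 := lt_le_trans c0 cc'.
rewrite !kernelE // ler_expR !mulNr lerN2 ler_wpM2l ?sqr_ge0 //.
by rewrite lef_pV2 ?posrE ?mulr_gt0 // ler_pM2l.
Qed.

Let peak_le (c c' : R) : 0 < c -> c <= c' ->
  Num.sqrt (2 / (pi * c')) <= Num.sqrt (2 / (pi * c)).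
Proof.
move=> c0 cc'; have c'0 := lt_le_trans c0 cc'.
rewrite ler_wsqrtr // ler_pM2l // lef_pV2 ?posrE ?mulr_gt0 ?pi_gt0 //.
by rewrite ler_pM2l ?pi_gt0.
Qed.

Hypothesis Theta1 : 1 < Theta.
Variables (C0 C1 h : R).
Hypotheses (hC0 : coin_constant C0) (C01 : C0 <= C1) (C1pos : 0 <= C1).
Hypothesis (h023 : 0 <= h <= 2 / 3).

Let err := 6 * C1 / (Theta * Num.sqrt Theta).

(** Off the deviation event B w lies between (1 - h) Theta and (1 + h) Theta, and
    the peak $\sqrt{2/(\pi N)}$ decreases in N while the width increases.  On the
    event itself both left-hand sides are at most 1; for the kernel this uses
    Theta > 1. *)
Lemma hitting_weight_squeeze (K : int) :
  let kappa := lattice_point (v0 * n%:R) D K in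
  {ae Q, forall w, 1 * hitting_weight kappa w
     <= Num.sqrt (2 / (pi * ((1 - h) * Theta)))
        * kernel (D / 2 * Num.sqrt ((1 + h) * Theta)) kappa w
        + err + \1_(deviation_event h) w}
  /\ {ae Q, forall w, Num.sqrt (2 / (pi * ((1 + h) * Theta)))
        * kernel (D / 2 * Num.sqrt ((1 - h) * Theta)) kappa w
     <= 1 * hitting_weight kappa w + err + \1_(deviation_event h) w}.
Proof.
move=> kappa; have /andP[h0 h1] := h023.
have T0 : 0 < Theta by exact: lt_trans Theta1.
have hT : h * Theta <= 2 / 3 * Theta by rewrite ler_wpM2r // ltW.
have m0 : 0 < (1 - h) * Theta by rewrite mulrBl mul1r; lra.
have p0 : 0 < (1 + h) * Theta by rewrite mulr_gt0 //; lra.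
have err0 : 0 <= err by rewrite divr_ge0 ?mulr_ge0 ?sqrtr_ge0 // ltW.
have good : {ae Q, forall w, ~ deviation_event h w ->
    (1 - h) * Theta <= B w <= (1 + h) * Theta
    /\ `|hitting_weight kappa w - Num.sqrt (2 / (pi * B w))
         * kernel (D / 2 * Num.sqrt (B w)) kappa w| <= err}.
  apply: filterS (hitting_weight_near K hC0) => w near /negP.
  rewrite -leNgt ler_norml => /andP[lo up].
  have Blo : (1 - h) * Theta <= B w by rewrite mulrBl mul1r; lra.
  have B0 : 0 < B w by exact: lt_le_trans Blo.
  split; first by rewrite Blo mulrDl mul1r; lra.
  rewrite kernelE //; apply: le_trans (near B0) _.
  apply: (@le_trans _ _ (C1 * B w `^ (- (3 / 2)))).
    by rewrite ler_wpM2r // powR_ge0.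
  (* (1 - h) Theta >= Theta / 3, and 3 ^ (3 / 2) <= 6 *)
  rewrite /err -(mulrC C1) -mulrA ler_wpM2l // powR_three_halves_le //.
  by move: Blo; rewrite mulrBl mul1r; lra.
have peak0 c : 0 <= Num.sqrt (2 / (pi * c)) :> R by exact: sqrtr_ge0.
split; apply: filterS good => w good; rewrite mul1r indicE;
  case: (boolP (w \in _)) => [_|/negP wd] /=.
- have /andP[_ w1] := hitting_weight01 kappa w.
  have := kernel01 (D / 2 * Num.sqrt ((1 + h) * Theta)) kappa w.
  move=> /andP[k0 _]; have := mulr_ge0 (peak0 ((1 - h) * Theta)) k0; lra.
- have [/andP[lo up]] := good (fun dw => wd (mem_set dw)).
  rewrite ler_norml => /andP[_ near].
  have B0 : 0 < B w by exact: lt_le_trans lo.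
  have := @ler_pM _ _ _ _ _ (peak0 (B w)) (proj1 (andP (kernel01 _ _ _)))
    (peak_le m0 lo) (kernel_le kappa w B0 up).
  lra.
- have /andP[w0 _] := hitting_weight01 kappa w.
  have /andP[k0 k1] := kernel01 (D / 2 * Num.sqrt ((1 - h) * Theta)) kappa w.
  have pk1 : Num.sqrt (2 / (pi * ((1 + h) * Theta))) <= 1 :> R.
    rewrite -[X in _ <= X]sqrtr1 ler_wsqrtr // ler_pdivrMr ?(mulr_gt0 (pi_gt0 R) p0) //.
    rewrite mul1r; apply: le_trans (pi_ge2 R) _; rewrite ler_peMr ?pi_ge0 //.
    by rewrite mulrDl mul1r; have := mulr_ge0 h0 (ltW T0); move: Theta1; lra.
  have := @ler_pM _ _ _ _ _ (peak0 ((1 + h) * Theta)) k0 pk1 k1.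
  lra.
- have [/andP[lo up]] := good (fun dw => wd (mem_set dw)).
  rewrite ler_norml => /andP[near _].
  have B0 : 0 < B w by exact: lt_le_trans lo.
  have := @ler_pM _ _ _ _ _ (peak0 ((1 + h) * Theta)) (proj1 (andP (kernel01 _ _ _)))
    (peak_le B0 up) (kernel_le kappa w m0 lo).
  lra.
Qed.

Hypothesis h_def : h ^+ 2 = 6 * (ln Theta / Theta).

(** Integrate the squeeze and compare S' with a normal variable; the constants are
    collected in [gaussian_comparison]. *)
Lemma local_limit (x : R) : lattice (v0 * n%:R) D x ->
  `| fine (P [set w | S w = x])
     - D * expR (- (x - mean P S) ^+ 2 / (2 * var P S))
       / Num.sqrt (2 * pi * var P S) |
  <= 12 * (C1 + 1) * (D * Num.sqrt (ln Theta / (var P S * Theta))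
           + (normal_distance Q S' + Theta^-1) / Num.sqrt Theta).
Proof.
move=> [K _ <-]; set kappa := lattice_point _ _ K.
have /andP[h0 h1] := h023.
have T0 : 0 < Theta by exact: lt_trans Theta1.
have err0 : 0 <= err by rewrite divr_ge0 ?mulr_ge0 ?sqrtr_ge0 // ltW.
have m0 : 0 < (1 - h) * Theta by rewrite mulr_gt0 //; lra.
have p0 : 0 < (1 + h) * Theta by rewrite mulr_gt0 //; lra.
have dev : fine (Q (deviation_event h)) <= 2 / (Theta * Num.sqrt Theta).
  apply: le_trans (deviation_probability h023) _.
  rewrite (_ : Theta * h ^+ 2 / 4 = 3 / 2 * ln Theta) ?expR_three_halves //.
  by rewrite h_def; field; rewrite gt_eqF.
have var_S' : var Q S' = var P S - D ^+ 2 * Theta / 4.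
  by rewrite symmetrized_var addrK.
have D2 : D ^+ 2 * Theta / 4 <= var P S.
  by rewrite symmetrized_var lerDr (var_ge0 (symmetrized_square_lty _)).
have [up lo] := hitting_weight_squeeze K.
have [mhw hw01] := (measurable_hitting_weight kappa, hitting_weight01 kappa).
have mdev := measurable_deviation_event h.
have {}up := ae_le_fine_integral mhw (measurable_kernel _ kappa) mdev hw01
  (kernel01 _ kappa) ler01 (sqrtr_ge0 _) err0 up.
have {}lo := ae_le_fine_integral (measurable_kernel _ kappa) mhw mdev
  (kernel01 _ kappa) hw01 (sqrtr_ge0 _) ler01 err0 lo.
rewrite !mul1r -point_probability in up lo.
have smooth c : 0 < c -> `|fine (\int[Q]_w (kernel (D / 2 * Num.sqrt c) kappa w)%:E)%E
   - (D / 2 * Num.sqrt c) / Num.sqrt ((D / 2 * Num.sqrt c) ^+ 2 + (var P S - D ^+ 2 * Theta / 4))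
     * expR (- (kappa - mean P S) ^+ 2
         / (2 * ((D / 2 * Num.sqrt c) ^+ 2 + (var P S - D ^+ 2 * Theta / 4))))|
   <= 2 * normal_distance Q S'.
  move=> c0; rewrite -var_S' symmetrized_mean.
  apply: (gaussian_smoothing mS' (symmetrized_square_lty _)).
  by rewrite mulr_gt0 ?divr_gt0 ?sqrtr_gt0.
have [cup clo] := @gaussian_comparison R Theta D (var P S) (kappa - mean P S)
  (normal_distance Q S') h C1 Theta1 D0 D2 (normal_distance_ge0 Q mS') C1pos h023 h_def.
move: (smooth _ p0) (smooth _ m0).
rewrite !ler_norml => /andP[_ s1] /andP[s2 _].
rewrite lerBlDl in s1; rewrite lerBrDl in s2.
have s1' := ler_wpM2l (sqrtr_ge0 (2 / (pi * ((1 - h) * Theta)))) s1.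
have s2' := ler_wpM2l (sqrtr_ge0 (2 / (pi * ((1 + h) * Theta)))) s2.
rewrite /err in up lo.
apply/andP; split.
- rewrite lerBrDl lerBlDr.
  apply: le_trans clo _; rewrite lerD2r lerBlDr; apply: le_trans s2' _.
  by apply: le_trans lo _; rewrite -addrA lerD2l lerD2l.
- rewrite lerBlDl; apply: le_trans cup.
  by apply: le_trans up _; rewrite -[X in X <= _]addrA; apply: lerD => //; rewrite lerD2l.
Qed.

End sum_law.

Theorem corollary1p8 (R : realType) (v0 D : R) (hD : 0 < D)
  (C0 : R) (hC0 : coin_constant C0)
  (n : nat) (hn : (1 <= n)%N)
  (d : measure_display) (T : measurableType d) (P : probability T R)
  (X : 'I_n -> {RV P >-> R})
  (hXindep : mutually_independent P (fun j => X j : T -> R))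
  (hXL2 : forall j, (X j : T -> R) \in Lfun P 2%:E)
  (hXlattice : forall j, P [set w | lattice v0 D (X j w)] = 1%E)
  (hoverlap : forall j, 0 < overlap v0 D P (X j))
  (theta : 'I_n -> R)
  (htheta : forall j, 0 < theta j <= overlap v0 D P (X j))
  (d' : measure_display) (T' : measurableType d') (Q : probability T' R)
  (V eps : 'I_n -> {RV Q >-> R})
  (hVeps : is_bernoulli_part v0 D P (fun j => X j : T -> R) theta
             Q (fun j => V j : T' -> R) (fun j => eps j : T' -> R)) :
  let S := fun w => \sum_(j < n) X j w in
  let W := fun w => \sum_(j < n) V j w in
  let B := fun w => \sum_(j < n) eps j w in
  let S' := fun w => W w + D / 2 * B w in
  let Theta := \sum_(j < n) theta j in
  let H := normal_distance Q S' in
  let C1 := Num.max 4 C0 in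
  let C2 := 12 * (C1 + 1) in
  1 < Theta -> ln Theta / Theta <= 14^-1 ->
  forall kappa : R, lattice (v0 * n%:R) D kappa ->
  (kappa - mean P S) ^+ 2 / var P S <= Num.sqrt (Theta / (14 * ln Theta)) ->
  `| fine (P [set w | S w = kappa])
     - D * expR (- (kappa - mean P S) ^+ 2 / (2 * var P S))
       / Num.sqrt (2 * pi * var P S) |
  <= C2 * (D * Num.sqrt (ln Theta / (var P S * Theta))
           + (H + Theta^-1) / Num.sqrt Theta).
Proof.
move=> S W B S' Theta H C1 C2 Theta1 logTheta kappa hkappa _.
have Theta0 : 0 < Theta by exact: lt_trans Theta1.
have log0 : 0 <= ln Theta / Theta by rewrite divr_ge0 ?ln_ge0 // ltW.
(* this h makes the exponent Theta * h ^+ 2 / 4 of the Chernoff bound equal to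
   3 / 2 * ln Theta, and the bound on ln Theta / Theta gives h <= 2 / 3 *)
pose h := Num.sqrt (6 * (ln Theta / Theta)).
have h_def : h ^+ 2 = 6 * (ln Theta / Theta) by rewrite sqr_sqrtr // mulr_ge0.
have h023 : 0 <= h <= 2 / 3.
  rewrite sqrtr_ge0 /= -[2 / 3]ger0_norm // -sqrtr_sqr ler_wsqrtr //.
  by move: logTheta; lra.
have C01 : C0 <= C1 by rewrite le_max lexx orbT.
have C1pos : 0 <= C1 by rewrite le_max ler0n.
exact: (local_limit hD hXindep hXlattice hoverlap htheta hVeps hXL2 Theta1
          hC0 C01 C1pos h023 h_def hkappa).
Qed.
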